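(* Let $\mathcal L$ be a team-based propositional logic whose atoms are polynomial-time checkable. Then the satisfiability problem for $\mathcal L$, parameterised by $k$, is in $\mathrm{FPT}$ for each $k\in\{\mathrm{formula\text{-}size},\ \mathrm{formula\text{-}depth},\ \mathrm{variables}\}$.
   Context: Team semantics. An assignment maps propositional variables to $\{0,1\}$; a team is a finite set of assignments over a common finite set of variables. A team-based propositional logic $\mathcal L$ has formulas $\varphi ::= \top\mid\bot\mid x\mid\neg x\mid\alpha\mid\varphi\land\varphi\mid\varphi\lor\varphi$ with $\alpha$ ranging over its atoms, with semantics: $T\models\top$ always; $T\models\bot$ iff $T=\emptyset$; $T\models x$ (resp. $\neg x$) iff every $t\in T$ has $t(x)=1$ (resp. $0$); $\land$ is evaluated on the same team; $T\models\varphi\lor\psi$ iff $T=T_1\cup T_2$ with $T_1\models\varphi$, $T_2\models\psi$ (lax semantics; strict semantics additionally requires $T_1\cap T_2=\emptyset$). Atoms are polynomial-time checkable if for every atom $\alpha$ and team $T$, $T\models\alpha$ is decidable in polynomial time. Satisfiability problem: given a formula $\varphi$, decide whether there is a non-empty team $T$ with $T\models\varphi$. Parameters: $\mathrm{formula\text{-}size}=|\varphi|$; $\mathrm{formula\text{-}depth}$ = length of the longest root-to-leaf path of the syntax tree of $\varphi$; $\mathrm{variables}$ = number of distinct variables in $\varphi$. A parameterised problem is in $\mathrm{FPT}$ if instances $(x,k)$ are decidable deterministically in time $f(k)\cdot p(|x|)$, $f$ computable, $p$ polynomial.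
   Formalization: Satisfying teams range over exactly the variables of the formula (with arbitrary extra variables, non-local atoms can make satisfiability undecidable), and atoms are syntax trees of fan-out at most two that count towards formula-depth (with unbounded fan-out the depth claim fails). *)

(* Defs.v *)
From mathcomp Require Import all_boot all_order all_algebra finmap.
Set Implicit Arguments.
Unset Strict Implicit.
Unset Printing Implicit Defensive.
Local Open Scope fset_scope.
Local Open Scope fmap_scope.

(** * Team-based propositional logics *)

Definition word := seq bool.

Definition var := word.

Definition assignment := {fmap var -> bool}.
Definition team := {fset assignment}.

(** The condition is vacuous for the empty team, which is a team over every
    finite set of variables. *)
Definition team_over (X : {fset var}) (T : team) : Prop :=
  forall t : assignment, t \in T -> domf t = X.

(** Atoms are written as syntax trees whose inner nodes and leaves carry an
    arbitrary symbol.  The trees have fan-out at most two, like those of the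
    formulas around them; a longer list of arguments is built with a binary
    list symbol, e.g. =(x,y;z) is  SBin dep (SBin comma x y) z. *)
Inductive syn :=
| SVar (x : var)
| SSym (a : word)
| SUn (a : word) (s : syn)
| SBin (a : word) (s1 s2 : syn).

Fixpoint syn_vars (s : syn) : {fset var} :=
  match s with
  | SVar x => [fset x]
  | SSym _ => fset0
  | SUn _ s => syn_vars s
  | SBin _ s1 s2 => syn_vars s1 `|` syn_vars s2
  end.

Fixpoint syn_size (s : syn) : nat :=
  match s with
  | SVar _ | SSym _ => 1
  | SUn _ s => (syn_size s).+1
  | SBin _ s1 s2 => (syn_size s1 + syn_size s2).+1
  end.

Fixpoint syn_depth (s : syn) : nat :=
  match s with
  | SVar _ | SSym _ => 0
  | SUn _ s => (syn_depth s).+1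
  | SBin _ s1 s2 => (maxn (syn_depth s1) (syn_depth s2)).+1
  end.

(** A logic is determined by its atoms: the way they are written and their
    semantics, which is an arbitrary relation between teams and atoms. *)
Record team_logic := TeamLogic {
  atom : Type;
  atom_syn : atom -> syn;
  atom_sat : team -> atom -> Prop
}.

Inductive formula (L : team_logic) :=
| FTop
| FBot
| FVar (x : var)
| FNeg (x : var)
| FAtom (a : atom L)
| FAnd (p q : formula L)
| FOr (p q : formula L).

Variant semantics := lax | strict.

Fixpoint sat (L : team_logic) (sem : semantics) (T : team) (p : formula L)
    : Prop :=
  match p with
  | FTop => True
  | FBot => T = fset0
  | FVar x => forall t : assignment, t \in T -> t.[? x] = Some true
  | FNeg x => forall t : assignment, t \in T -> t.[? x] = Some false
  | FAtom a => atom_sat T a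
  | FAnd p q => sat sem T p /\ sat sem T q
  | FOr p q => exists T1 T2 : team,
      [/\ T = T1 `|` T2, sem = strict -> T1 `&` T2 = fset0,
          sat sem T1 p & sat sem T2 q]
  end.

Fixpoint formula_vars (L : team_logic) (p : formula L) : {fset var} :=
  match p with
  | FTop | FBot => fset0
  | FVar x | FNeg x => [fset x]
  | FAtom a => syn_vars (atom_syn a)
  | FAnd p q | FOr p q => formula_vars p `|` formula_vars q
  end.

(** The satisfying team is a team over the variables of the formula.  This is
    not an innocent convention: atoms need not be local, so the truth of an
    atom may depend on the values of variables that do not occur in it. *)
Definition satisfiable (L : team_logic) (sem : semantics) (p : formula L)
    : Prop :=
  exists T : team,
    [/\ T != fset0, team_over (formula_vars p) T & sat sem T p].

(** Size and depth are those of the whole syntax tree, in which a negated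
    variable is a node with one child and an atom is the tree [atom_syn]:
    the number of nodes, and the length in edges of a longest branch. *)
Fixpoint formula_size (L : team_logic) (p : formula L) : nat :=
  match p with
  | FTop | FBot | FVar _ => 1
  | FNeg _ => 2
  | FAtom a => syn_size (atom_syn a)
  | FAnd p q | FOr p q => (formula_size p + formula_size q).+1
  end.

Fixpoint formula_depth (L : team_logic) (p : formula L) : nat :=
  match p with
  | FTop | FBot | FVar _ => 0
  | FNeg _ => 1
  | FAtom a => syn_depth (atom_syn a)
  | FAnd p q | FOr p q => (maxn (formula_depth p) (formula_depth q)).+1
  end.

Definition variables (L : team_logic) (p : formula L) : nat :=
  #|` formula_vars p|.

(** * Deterministic computation

    The machine model is the WHILE language of N. D. Jones (Computability and
    Complexity from a Programming Perspective, MIT Press, 1997).  A program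
    manipulates finitely many registers holding binary trees (lists, as in
    Lisp); one elementary operation has cost one.  An operation creates at most
    one new cell and inspects only the root of a tree, so that a store can be
    kept as a shared acyclic graph whose number of cells is at most the size of
    the input plus the running time (plus a constant).  The model and
    deterministic multitape Turing machines therefore simulate each other with
    polynomial overhead: they define the same computable functions, the same
    polynomial time and the same fixed-parameter tractable problems. *)

Inductive tree := Nil | Cons (a b : tree).

Definition hd (d : tree) : tree := if d is Cons a _ then a else Nil.
Definition tl (d : tree) : tree := if d is Cons _ b then b else Nil.

Fixpoint tree_size (d : tree) : nat :=
  if d is Cons a b then (tree_size a + tree_size b).+1 else 1.

Inductive expr :=
| EReg (r : nat)
| ENil
| ECons (e1 e2 : expr)
| EHd (e : expr)
| ETl (e : expr).

Definition store := nat -> tree.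

Fixpoint eval (s : store) (e : expr) : tree :=
  match e with
  | EReg r => s r
  | ENil => Nil
  | ECons e1 e2 => Cons (eval s e1) (eval s e2)
  | EHd e => hd (eval s e)
  | ETl e => tl (eval s e)
  end.

Fixpoint cost (e : expr) : nat :=
  match e with
  | EReg _ | ENil => 1
  | ECons e1 e2 => (cost e1 + cost e2).+1
  | EHd e | ETl e => (cost e).+1
  end.

(** Every tree other than [Nil] counts as true in a test. *)
Inductive cmd :=
| Assign (r : nat) (e : expr)
| Seq (c1 c2 : cmd)
| If (e : expr) (c1 c2 : cmd)
| While (e : expr) (c : cmd).

Definition update (s : store) (r : nat) (d : tree) : store :=
  fun r' => if r' == r then d else s r'.

(** [exec c s n s']: started in the store [s], the command [c] halts in the
    store [s'] after [n] steps. *)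
Inductive exec : cmd -> store -> nat -> store -> Prop :=
| exec_assign r e s :
    exec (Assign r e) s (cost e).+1 (update s r (eval s e))
| exec_seq c1 c2 s1 n1 s2 n2 s3 :
    exec c1 s1 n1 s2 -> exec c2 s2 n2 s3 ->
    exec (Seq c1 c2) s1 (n1 + n2) s3
| exec_if_true e c1 c2 s n s' :
    eval s e <> Nil -> exec c1 s n s' ->
    exec (If e c1 c2) s ((cost e).+1 + n) s'
| exec_if_false e c1 c2 s n s' :
    eval s e = Nil -> exec c2 s n s' ->
    exec (If e c1 c2) s ((cost e).+1 + n) s'
| exec_while_true e c s1 n1 s2 n2 s3 :
    eval s1 e <> Nil -> exec c s1 n1 s2 -> exec (While e c) s2 n2 s3 ->
    exec (While e c) s1 ((cost e).+1 + n1 + n2) s3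
| exec_while_false e c s :
    eval s e = Nil ->
    exec (While e c) s (cost e).+1 s.

Lemma exec_deterministic c s n1 s1 n2 s2 :
  exec c s n1 s1 -> exec c s n2 s2 -> n1 = n2 /\ s1 = s2.
Proof.
move=> E1; elim: E1 n2 s2 => {c s n1 s1}.
- by move=> r e s n2 s2 E; inversion E.
- move=> c1 c2 s1 n1 s2 n2 s3 _ IH1 _ IH2 m s E; inversion E; subst.
  have [? ?] := IH1 _ _ ltac:(eassumption); subst.
  by have [? ?] := IH2 _ _ ltac:(eassumption); subst.
- move=> e c1 c2 s n s' t _ IH m s2 E; inversion E; subst => //.
  by have [? ?] := IH _ _ ltac:(eassumption); subst.
- move=> e c1 c2 s n s' t _ IH m s2 E; inversion E; subst => //.
  by have [? ?] := IH _ _ ltac:(eassumption); subst.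
- move=> e c s1 n1 s2 n2 s3 t _ IH1 _ IH2 m s E; inversion E; subst => //.
  have [? ?] := IH1 _ _ ltac:(eassumption); subst.
  by have [? ?] := IH2 _ _ ltac:(eassumption); subst.
- by move=> e c s f m s2 E; inversion E; subst.
Qed.

(** Register 0 holds the input and the output; the others start as [Nil]. *)
Definition init (d : tree) : store := fun r => if r == 0 then d else Nil.

Definition decides_within (c : cmd) (d : tree) (A : Prop) (b : nat) : Prop :=
  exists (n : nat) (s : store),
    [/\ exec c (init d) n s, n <= b & s 0 <> Nil <-> A].

Definition code_nat (n : nat) : tree := iter n (Cons Nil) Nil.

Definition computable (f : nat -> nat) : Prop :=
  exists c : cmd, forall k : nat, exists (n : nat) (s : store),
    exec c (init (code_nat k)) n s /\ s 0 = code_nat (f k).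

(** * Decision problems *)

(** A promise problem: only the codes of valid instances are considered. *)
Record problem := Problem {
  instance : Type;
  valid : instance -> Prop;
  code : instance -> tree;
  yes : instance -> Prop
}.

Definition in_P (Q : problem) : Prop :=
  exists (c : cmd) (p : {poly nat}), forall i : instance Q, valid i ->
    decides_within c (code i) (yes i) p.[tree_size (code i)]%R.

(** The input is the pair of the instance and of the value of the parameter. *)
Definition in_FPT (Q : problem) (kappa : instance Q -> nat) : Prop :=
  exists (c : cmd) (f : nat -> nat) (p : {poly nat}),
    computable f /\
    forall i : instance Q, valid i ->
      decides_within c (Cons (code i) (code_nat (kappa i))) (yes i)
        (f (kappa i) * p.[tree_size (code i)]%R).

Definition code_seq (A : Type) (f : A -> tree) (s : seq A) : tree :=
  foldr (fun x d => Cons (f x) d) Nil s.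

Definition code_bool (b : bool) : tree := if b then Cons Nil Nil else Nil.

Definition code_word (w : word) : tree := code_seq code_bool w.

Fixpoint code_syn (s : syn) : tree :=
  match s with
  | SVar x => Cons (code_nat 0) (code_word x)
  | SSym a => Cons (code_nat 1) (code_word a)
  | SUn a s => Cons (code_nat 2) (Cons (code_word a) (code_syn s))
  | SBin a s1 s2 =>
      Cons (code_nat 3) (Cons (code_word a) (Cons (code_syn s1) (code_syn s2)))
  end.

Fixpoint code_formula (L : team_logic) (p : formula L) : tree :=
  match p with
  | FTop => Cons (code_nat 0) Nil
  | FBot => Cons (code_nat 1) Nil
  | FVar x => Cons (code_nat 2) (code_word x)
  | FNeg x => Cons (code_nat 3) (code_word x)
  | FAtom a => Cons (code_nat 4) (code_syn (atom_syn a))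
  | FAnd p q => Cons (code_nat 5) (Cons (code_formula p) (code_formula q))
  | FOr p q => Cons (code_nat 6) (Cons (code_formula p) (code_formula q))
  end.

(** A team is presented as a table without repetitions: the names of its
    variables in some order, and for each assignment, in some order, the bits
    that it gives to these variables. *)
Definition code_table (X : seq var) (ts : seq assignment) : tree :=
  Cons (code_seq code_word X)
       (code_seq (fun t : assignment =>
                    code_word [seq t.[? x] == Some true | x <- X]) ts).

Record atom_instance (L : team_logic) := AtomInstance {
  ai_atom : atom L;
  ai_vars : seq var;
  ai_rows : seq assignment
}.

Definition ai_team (L : team_logic) (i : atom_instance L) : team :=
  [fset t in ai_rows i].

Definition atom_checking (L : team_logic) : problem := {|
  instance := atom_instance L;
  valid := fun i =>
    [/\ uniq (ai_vars i), uniq (ai_rows i),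
        team_over [fset x in ai_vars i] (ai_team i)
      & syn_vars (atom_syn (ai_atom i)) `<=` [fset x in ai_vars i]];
  code := fun i =>
    Cons (code_syn (atom_syn (ai_atom i))) (code_table (ai_vars i) (ai_rows i));
  yes := fun i => atom_sat (ai_team i) (ai_atom i)
|}.

Definition satisfiability (L : team_logic) (sem : semantics) : problem := {|
  instance := formula L;
  valid := fun _ => True;
  code := @code_formula L;
  yes := @satisfiable L sem
|}.

(* Main.v *)
(** A formula with [v] variables has [2 ^ v] assignments and hence only
    [2 ^ 2 ^ v] teams.  Going through the formula bottom-up, one computes for
    every subformula the list of all teams that satisfy it: an atom is checked
    on each team, and a splitting disjunction is decided by trying all pairs of
    teams from the two lists below it.  The lists never exceed [2 ^ 2 ^ v]
    teams, so the time is polynomial in the size of the formula and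
    [2 ^ 2 ^ v].  Finally [v] is at most the size of the formula and at most [2]
    to the power of its depth, so one program serves all three parameters. *)
From mathcomp Require Import all_boot ssralg poly finmap boolp zify.
Require Import Defs.
Set Implicit Arguments.
Unset Strict Implicit.
Unset Printing Implicit Defensive.

(** * Calling programs from arbitrary stores *)

(** The obstacle is the machine model: running times must be proved for WHILE programs, while the
    data in between are doubly exponential in the number of variables. Hence no program is written
    out as a whole; [ptime] is a class of tree functions closed under composition, case distinction
    and loops, and its time is measured by a function [N] of the abstract instance rather than by
    the size of the encoded input. With [N] the size of the formula plus [2 ^ 2 ^ v], every list of
    teams has polynomial size, and nested loops stay polynomial because their bodies are timed by
    the outer [N] as well. As WHILE programs have no recursion, recursion on formulas becomes a fold
    over the nodes in postorder with a stack of results. The truth of an atom is a mere proposition,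
    made boolean by [[< >]]; its computational content comes from the assumed checker, which
    receives each team as a table. The final bound is a power of a sum, split into a polynomial in
    the formula times a function of the parameter. The same calculus, with another measure, shows
    that this function is computable. *)

Fixpoint expr_regs (e : expr) : nat :=
  match e with
  | EReg r => r.+1
  | ENil => 0
  | ECons e1 e2 => maxn (expr_regs e1) (expr_regs e2)
  | EHd e | ETl e => expr_regs e
  end.

Fixpoint cmd_regs (c : cmd) : nat :=
  match c with
  | Assign r e => maxn r.+1 (expr_regs e)
  | Seq c1 c2 => maxn (cmd_regs c1) (cmd_regs c2)
  | If e c1 c2 => maxn (expr_regs e) (maxn (cmd_regs c1) (cmd_regs c2))
  | While e c => maxn (expr_regs e) (cmd_regs c)
  end.

Lemma eval_agree e s t m : expr_regs e <= m -> (forall r, r < m -> s r = t r) ->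
  eval s e = eval t e.
Proof.
move=> + st; elim: e => /= [r|//|e1 IH1 e2 IH2|e IH /IH->|e IH /IH->] //.
  exact: st.
by rewrite geq_max => /andP[/IH1-> /IH2->].
Qed.

(** Allows a run known to start in [init d] to be replayed from a store in which the caller keeps
    data in higher registers. *)
Lemma exec_frame c s n s' t m :
  cmd_regs c <= m -> exec c s n s' -> (forall r, r < m -> s r = t r) ->
  exists t', [/\ exec c t n t', forall r, r < m -> s' r = t' r
               & forall r, m <= r -> t' r = t r].
Proof.
move=> + E; elim: E t => {c s n s'} /=.
- move=> r e s t; rewrite geq_max => /andP[rm em] st.
  exists (update t r (eval t e)); split; first exact: exec_assign.
    by move=> q qm; rewrite /update (eval_agree em st); case: eqP => // _; exact: st.
  by move=> q mq; rewrite /update; case: eqP mq => // ->; rewrite leqNgt rm.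
- move=> c1 c2 s1 n1 s2 n2 s3 _ IH1 _ IH2 t; rewrite geq_max => /andP[m1 m2] st.
  have [t1 [E1 h1 g1]] := IH1 _ m1 st.
  have [t2 [E2 h2 g2]] := IH2 _ m2 h1.
  exists t2; split=> //; first exact: exec_seq E1 E2.
  by move=> r mr; rewrite g2 ?g1.
- move=> e c1 c2 s n s' se _ IH t; rewrite !geq_max => /and3P[me m1 m2] st.
  have [t1 [E1 h1 g1]] := IH _ m1 st; exists t1; split=> //.
  by apply: exec_if_true => //; rewrite -(eval_agree me st).
- move=> e c1 c2 s n s' se _ IH t; rewrite !geq_max => /and3P[me m1 m2] st.
  have [t1 [E1 h1 g1]] := IH _ m2 st; exists t1; split=> //.
  by apply: exec_if_false => //; rewrite -(eval_agree me st).
- move=> e c s1 n1 s2 n2 s3 se _ IH1 _ IH2 t mm; move: (mm).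
  rewrite geq_max => /andP[me m1] st.
  have [t1 [E1 h1 g1]] := IH1 _ m1 st.
  have [t2 [E2 h2 g2]] := IH2 _ mm h1.
  exists t2; split=> //.
    by apply: exec_while_true E1 E2; rewrite -(eval_agree me st).
  by move=> r mr; rewrite g2 ?g1.
- move=> e c s se t; rewrite geq_max => /andP[me _] st.
  exists t; split=> //; apply: exec_while_false.
  by rewrite -(eval_agree me st).
Qed.

Lemma update_eq s r d : update s r d r = d.
Proof. by rewrite /update eqxx. Qed.

Lemma update_ne s r d q : q <> r -> update s r d q = s q.
Proof. by rewrite /update; case: eqP. Qed.

(** The language has no skip command, so the base case already assigns; register 1 is reset even for
    [m = 0], which explains [maxn 1 m] in the frame conditions. *)
Fixpoint clear (m : nat) : cmd :=
  if m is m'.+1 then Seq (clear m') (Assign m ENil) else Assign 1 ENil.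

Lemma exec_clear m s : exists s', [/\ exec (clear m) s (m.+1).*2 s',
  s' 0 = s 0, forall r, 0 < r <= m -> s' r = Nil
  & forall r, maxn 1 m < r -> s' r = s r].
Proof.
elim: m => [|m [s' [E h0 h1 h2]]] /=.
  exists (update s 1 Nil); split=> //; first exact: exec_assign.
    by move=> r; case: r.
  by move=> [|[|r]].
exists (update s' m.+1 Nil); split => //.
- by rewrite doubleS -addn2; apply: exec_seq E _; exact: exec_assign.
- move=> r /andP[r0 rm]; rewrite /update; case: eqP => // rm'.
  by apply: h1; lia.
- move=> r rm; rewrite /update; case: eqP => [|_]; first by lia.
  by apply: h2; lia.
Qed.

(** A program relies on all registers but [0] being [Nil] at the start; the
    registers above [m] are free for the caller. *)
Definition call (m : nat) (c : cmd) : cmd := Seq (clear m) c.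

Lemma exec_call m c d n s t :
  cmd_regs c <= m.+1 -> exec c (init d) n s -> t 0 = d ->
  exists t', [/\ exec (call m c) t ((m.+1).*2 + n) t', t' 0 = s 0
    & forall r, maxn 1 m < r -> t' r = t r].
Proof.
move=> cm E t0; have [t1 [E1 h0 h1 h2]] := exec_clear m t.
have agree r : r < m.+1 -> init d r = t1 r.
  by case: r => [|r] rm; rewrite /init /= ?h0 ?t0 // h1.
have [t2 [E2 g1 g2]] := exec_frame cm E agree.
exists t2; split; first exact: exec_seq E1 E2.
  by rewrite g1.
by move=> r mr; rewrite g2 ?h2 //; lia.
Qed.

(** * Polynomial bounds *)

(** Polynomial boundedness on [P]. The base is at least 2, so that the exponent absorbs constants
    and sums. *)
Definition small (A : Type) (P : A -> Prop) (N f : A -> nat) : Prop :=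
  exists k, forall a, P a -> f a <= (N a).+2 ^ k.

Lemma leq_expn2r m n k : m <= n -> m ^ k <= n ^ k.
Proof. by case: k => // k; rewrite leq_exp2r. Qed.

(** Both powers are at least 1, so their sum is at most twice their product; the additional factor
    [n.+2] pays for the 2. *)
Lemma expn_sum_le n j k : n.+2 ^ j + n.+2 ^ k <= n.+2 ^ (j + k).+1.
Proof.
have: 0 < n.+2 ^ j by rewrite expn_gt0.
have: 0 < n.+2 ^ k by rewrite expn_gt0.
by rewrite expnS expnD; set x := _ ^ j; set y := _ ^ k; nia.
Qed.

Section Small.
Context (A : Type) (P : A -> Prop) (N : A -> nat).
Implicit Types f g : A -> nat.

Lemma small_le f g : (forall a, P a -> f a <= g a) -> small P N g ->
  small P N f.
Proof. by move=> fg [k gk]; exists k => a Pa; apply: leq_trans (fg _ _) (gk _ _). Qed.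

Lemma small_const c : small P N (fun _ => c).
Proof.
exists c => a _; apply: leq_trans (ltnW (ltn_expl c (isT : 1 < 2))) _.
exact: leq_expn2r.
Qed.

Lemma small_id : small P N N.
Proof. by exists 1 => a _; rewrite expn1; lia. Qed.

Lemma small_add f g : small P N f -> small P N g ->
  small P N (fun a => f a + g a).
Proof.
move=> [j fj] [k gk]; exists (j + k).+1 => a Pa.
by apply: leq_trans (expn_sum_le _ _ _); apply: leq_add; auto.
Qed.

Lemma small_mul f g : small P N f -> small P N g ->
  small P N (fun a => f a * g a).
Proof.
move=> [j fj] [k gk]; exists (j + k) => a Pa.
by rewrite expnD; apply: leq_mul; auto.
Qed.

Lemma small_succ f : small P N f -> small P N (fun a => (f a).+1).
Proof.
move=> sf; apply: small_le (small_add sf (small_const 1)) => a _.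
by rewrite addn1.
Qed.

Lemma small_exp f k : small P N f -> small P N (fun a => f a ^ k).
Proof. by move=> [j fj]; exists (j * k) => a Pa; rewrite expnM leq_expn2r ?fj. Qed.

Lemma small_trans f g : small P N f ->
  (exists k, forall a, P a -> g a <= (f a).+2 ^ k) -> small P N g.
Proof. by move=> sf [k /small_le]; apply; apply/small_exp/small_succ/small_succ. Qed.
End Small.

Lemma small_reindex (A B : Type) (h : B -> A) (P : A -> Prop) (Q : B -> Prop)
    (N f : A -> nat) (M : B -> nat) :
  (forall b, Q b -> P (h b)) -> (forall b, M b = N (h b)) ->
  small P N f -> small Q M (fun b => f (h b)).
Proof. by move=> QP MN [k fk]; exists k => b Qb; rewrite MN fk //; apply: QP. Qed.

(** * Polynomial time relative to a size measure *)

(** The instances are the elements of [A] that satisfy [P]; the tree [enc a]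
    is mapped to the tree [out a] in time polynomial in [N a], which need not
    be the size of [enc a]. *)
Definition ptime (A : Type) (P : A -> Prop) (N : A -> nat)
    (enc out : A -> tree) : Prop :=
  exists c t, small P N t /\ forall a, P a -> exists n s,
    [/\ exec c (init (enc a)) n s, s 0 = out a & n <= t a].

Lemma ptime_ext_out (A : Type) (P : A -> Prop) (N : A -> nat)
    (enc out out' : A -> tree) :
  (forall a, P a -> out' a = out a) -> ptime P N enc out -> ptime P N enc out'.
Proof.
move=> oo [c [t [st ct]]]; exists c, t; split=> // a Pa.
by rewrite oo //; apply: ct.
Qed.

Lemma ptime_reindex (A B : Type) (h : B -> A) (P : A -> Prop) (Q : B -> Prop)
    (N : A -> nat) (M : B -> nat) (enc out : A -> tree) :
  (forall b, Q b -> P (h b)) -> small Q M (fun b => N (h b)) ->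
  ptime P N enc out ->
  ptime Q M (fun b => enc (h b)) (fun b => out (h b)).
Proof.
move=> QP sN [c [t [[k tk] ct]]]; exists c, (fun b => t (h b)); split.
  by apply: small_trans sN _; exists k => b Qb; apply/tk/QP.
by move=> b Qb; apply/ct/QP.
Qed.

Section Ptime.
Context (A : Type) (P : A -> Prop) (N : A -> nat).
Implicit Types enc out : A -> tree.

Lemma ptime_expr (e : expr) enc out :
  (forall a, P a -> eval (init (enc a)) e = out a) -> ptime P N enc out.
Proof.
move=> eo; exists (Assign 0 e), (fun _ => (cost e).+1); split=> [|a Pa].
  exact: small_const.
by do 2 eexists; split; [exact: exec_assign| |]; rewrite ?/update ?eo.
Qed.

(** Both times are measured by [N a] and not by the size of the tree passed on, so they merely add
    up, however large [mid a] is. *)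
Lemma ptime_comp enc mid out :
  ptime P N enc mid -> ptime P N mid out -> ptime P N enc out.
Proof.
move=> [c1 [t1 [st1 ct1]]] [c2 [t2 [st2 ct2]]]; pose m := cmd_regs c2.
exists (Seq c1 (call m c2)), (fun a => t1 a + ((m.+1).*2 + t2 a)); split.
  by do ?apply: small_add => //; apply: small_const.
move=> a Pa; have [n1 [s1 [E1 o1 l1]]] := ct1 _ Pa.
have [n2 [s2 [E2 o2 l2]]] := ct2 _ Pa.
have [s3 [E3 o3 _]] := exec_call (leqnSn m) E2 o1.
exists (n1 + ((m.+1).*2 + n2)), s3; split; rewrite ?o3 ?leq_add //.
exact: exec_seq E1 E3.
Qed.

Lemma ptime_cons enc out1 out2 :
  ptime P N enc out1 -> ptime P N enc out2 ->
  ptime P N enc (fun a => Cons (out1 a) (out2 a)).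
Proof.
move=> [c1 [t1 [st1 ct1]]] [c2 [t2 [st2 ct2]]].
(* Calls leave the registers above [m] intact: [m.+1] keeps the input and [m.+2] the first
   result. *)
pose m := maxn 1 (maxn (cmd_regs c1) (cmd_regs c2)).
exists (Seq (Assign m.+1 (EReg 0)) (Seq (call m c1)
  (Seq (Assign m.+2 (EReg 0)) (Seq (Assign 0 (EReg m.+1)) (Seq (call m c2)
  (Assign 0 (ECons (EReg m.+2) (EReg 0)))))))).
exists (fun a => 2 + (((m.+1).*2 + t1 a) + (2 + (2 + (((m.+1).*2 + t2 a) + 4))))).
split; first by do ?apply: small_add => //; apply: small_const.
move=> a Pa; have [n1 [s1 [E1 o1 l1]]] := ct1 _ Pa.
have [n2 [s2 [E2 o2 l2]]] := ct2 _ Pa.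
have m_gt0 : 0 < m by rewrite /m; lia.
have m1 : cmd_regs c1 <= m.+1 by rewrite /m; lia.
have m2 : cmd_regs c2 <= m.+1 by rewrite /m; lia.
have [s3 [E3 o3 f3]] := exec_call (t := update (init (enc a)) m.+1 (enc a)) m1 E1 erefl.
pose s4 := update s3 m.+2 (s3 0); pose s5 := update s4 0 (s4 m.+1).
have s50 : s5 0 = enc a.
  rewrite /s5 update_eq /s4 update_ne; last by lia.
  by rewrite f3 ?update_eq //; lia.
have [s6 [E6 o6 f6]] := exec_call m2 E2 s50.
exists (2 + (((m.+1).*2 + n1) + (2 + (2 + (((m.+1).*2 + n2) + 4))))).
exists (update s6 0 (Cons (s6 m.+2) (s6 0))); split.
- apply: exec_seq (exec_assign _ _ _) _; apply: exec_seq E3 _.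
  apply: exec_seq (exec_assign _ _ _) _; apply: exec_seq (exec_assign _ _ _) _.
  by apply: exec_seq E6 _; apply: exec_assign.
- rewrite /update /= f6; last by lia.
  by rewrite /s5 /s4 /update /= eqxx o6 o2 o3 o1.
- by rewrite !leq_add.
Qed.

Lemma ptime_case (test : A -> tree) enc out :
  ptime P N enc test ->
  ptime (fun a => P a /\ test a <> Nil) N enc out ->
  ptime (fun a => P a /\ test a = Nil) N enc out ->
  ptime P N enc out.
Proof.
move=> [c0 [t0 [[k0 st0] ct0]]] [c1 [t1 [[k1 st1] ct1]]] [c2 [t2 [[k2 st2] ct2]]].
pose m := maxn 1 (maxn (cmd_regs c0) (maxn (cmd_regs c1) (cmd_regs c2))).
exists (Seq (Assign m.+1 (EReg 0)) (Seq (call m c0)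
  (Seq (Assign m.+2 (EReg 0)) (Seq (Assign 0 (EReg m.+1))
  (If (EReg m.+2) (call m c1) (call m c2)))))).
(* The times [t1] and [t2] are bounded only on their own branches, so explicit powers replace them
   in a bound valid on all of [P]. *)
exists (fun a => 2 + (((m.+1).*2 + (N a).+2 ^ k0) +
  (2 + (2 + (2 + ((m.+1).*2 + ((N a).+2 ^ k1 + (N a).+2 ^ k2))))))).
split.
  do ?apply: small_add; try exact: small_const.
  - by exists k0.
  - by exists k1.
  - by exists k2.
move=> a Pa; have [n0 [s0 [E0 o0 l0]]] := ct0 _ Pa.
have m0 : cmd_regs c0 <= m.+1 by rewrite /m; lia.
have m_gt0 : 0 < m by rewrite /m; lia.
have m1 : cmd_regs c1 <= m.+1 by rewrite /m; lia.
have m2 : cmd_regs c2 <= m.+1 by rewrite /m; lia.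
have [s3 [E3 o3 f3]] := exec_call (t := update (init (enc a)) m.+1 (enc a)) m0 E0 erefl.
pose s4 := update s3 m.+2 (s3 0); pose s5 := update s4 0 (s4 m.+1).
have s50 : s5 0 = enc a.
  rewrite /s5 update_eq /s4 update_ne; last by lia.
  by rewrite f3 ?update_eq //; lia.
have s5m : s5 m.+2 = test a by rewrite /s5 /s4 /update /= eqxx o3.
have l0' := leq_trans l0 (st0 _ Pa).
have [n [s [E o l]]] : exists n s,
  [/\ exec (If (EReg m.+2) (call m c1) (call m c2)) s5 n s,
    s 0 = out a & n <= 2 + ((m.+1).*2 + ((N a).+2 ^ k1 + (N a).+2 ^ k2))].
  have [t0N|t0N] := pselect (test a = Nil).
    have Pa' : P a /\ test a = Nil by [].
    have [n [s [E o l]]] := ct2 _ Pa'.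
    have [s' [E' o' _]] := exec_call m2 E s50.
    exists (2 + ((m.+1).*2 + n)), s'; split; rewrite ?o' //.
      by apply: (exec_if_false (e := EReg m.+2)) => //=; rewrite s5m.
    by rewrite !leq_add2l (leq_trans (leq_trans l (st2 _ Pa'))) ?leq_addl.
  have Pa' : P a /\ test a <> Nil by [].
  have [n [s [E o l]]] := ct1 _ Pa'.
  have [s' [E' o' _]] := exec_call m1 E s50.
  exists (2 + ((m.+1).*2 + n)), s'; split; rewrite ?o' //.
    by apply: (exec_if_true (e := EReg m.+2)) => //=; rewrite s5m.
  by rewrite !leq_add2l (leq_trans (leq_trans l (st1 _ Pa'))) ?leq_addr.
exists (2 + (((m.+1).*2 + n0) + (2 + (2 + n)))), s; split=> //.
  apply: exec_seq (exec_assign _ _ _) _; apply: exec_seq E3 _.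
  apply: exec_seq (exec_assign _ _ _) _; apply: exec_seq (exec_assign _ _ _) _.
  exact: E.
by rewrite !leq_add.
Qed.

(** The loop runs the body on register [0] as long as the expression [e], which
    may only read that register, does not evaluate to [Nil]. *)
Lemma ptime_while (T : Type) (code : A -> T -> tree) (e : expr) (t0 : A -> T)
    (next : A -> T -> T) (Inv : A -> T -> Prop) (mu : A -> T -> nat) out :
  expr_regs e <= 1 ->
  (forall a, P a -> Inv a (t0 a)) ->
  small P N (fun a => mu a (t0 a)) ->
  (forall a t, P a -> Inv a t -> eval (init (code a t)) e <> Nil ->
     Inv a (next a t) /\ mu a (next a t) < mu a t) ->
  ptime (fun x : A * T => [/\ P x.1, Inv x.1 x.2 &
           eval (init (code x.1 x.2)) e <> Nil]) (fun x => N x.1)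
    (fun x => code x.1 x.2) (fun x => code x.1 (next x.1 x.2)) ->
  (forall a t, P a -> Inv a t -> eval (init (code a t)) e = Nil ->
     code a t = out a) ->
  ptime P N (fun a => code a (t0 a)) out.
Proof.
move=> e1 Inv0 smu Invs [c [tc [[k stc] ctc]]] fin.
pose m := maxn 1 (cmd_regs c); pose b a := (cost e).+1 + ((m.+1).*2 + (N a).+2 ^ k).
have mc : cmd_regs c <= m.+1 by rewrite /m; lia.
exists (While e (call m c)), (fun a => mu a (t0 a) * b a + (cost e).+1); split.
  apply: small_add; last exact: small_const.
  apply: small_mul => //; do ?apply: small_add; try exact: small_const.
  by exists k.
move=> a Pa.
have evE s d : s 0 = d -> eval s e = eval (init d) e.
  by move=> s0; apply: (eval_agree e1) => -[].
(* Induction on a bound [j] of the measure; a round costs at most [b a] in every loop state, as the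
   body is timed by [N a] alone. At [j = 0] the guard must fail, since a further round would
   decrease the measure. *)
have loop j : forall t s, mu a t <= j -> Inv a t -> s 0 = code a t -> exists n s',
    [/\ exec (While e (call m c)) s n s', s' 0 = out a & n <= j * b a + (cost e).+1].
  elim: j => [|j IH] t s muj It s0.
    have [eN|eN] := pselect (eval s e = Nil); last first.
      by case: (Invs a t Pa It); rewrite -?(evE _ _ s0) //; lia.
    exists (cost e).+1, s; split; [exact: exec_while_false| |by []].
    by rewrite s0; apply: fin => //; rewrite -(evE _ _ s0).
  have [eN|eN] := pselect (eval s e = Nil).
    exists (cost e).+1, s; split; [exact: exec_while_false| |by rewrite leq_addl].
    by rewrite s0; apply: fin => //; rewrite -(evE _ _ s0).
  have eN' : eval (init (code a t)) e <> Nil by rewrite -(evE _ _ s0).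
  have [I' mu'] := Invs a t Pa It eN'.
  have Px : [/\ P (a, t).1, Inv (a, t).1 (a, t).2 &
           eval (init (code (a, t).1 (a, t).2)) e <> Nil] by [].
  have [n [s1 [E1 o1 l1]]] := ctc (a, t) Px.
  have [s2 [E2 o2 _]] := exec_call mc E1 s0.
  have [n3 [s3 [E3 o3 l3]]] := IH (next a t) s2 ltac:(lia) I' (etrans o2 o1).
  exists ((cost e).+1 + ((m.+1).*2 + n) + n3), s3; split=> //.
    exact: exec_while_true E2 E3.
  rewrite mulSn -[b a + _ + _]addnA leq_add // /b leq_add2l leq_add2l.
  exact: leq_trans l1 (stc _ Px).
exact: (loop _ (t0 a) _ (leqnn _) (Inv0 a Pa) erefl).
Qed.
End Ptime.

Section PtimeBasics.
Context (A : Type) (P : A -> Prop) (N : A -> nat).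
Implicit Types enc out : A -> tree.

Lemma ptime_sub (Q : A -> Prop) enc out :
  (forall a, Q a -> P a) -> ptime P N enc out -> ptime Q N enc out.
Proof.
move=> QP; apply: (ptime_reindex (h := id)) => //.
exact: small_id.
Qed.

Lemma ptime_id enc : ptime P N enc enc.
Proof. exact: (ptime_expr _ (e := EReg 0)). Qed.

Lemma ptime_const enc (d : tree) : ptime P N enc (fun _ => d).
Proof.
elim: d => [|d1 IH1 d2 IH2]; first exact: (ptime_expr _ (e := ENil)).
exact: ptime_cons.
Qed.

Lemma ptime_hd enc out : ptime P N enc out -> ptime P N enc (fun a => hd (out a)).
Proof. by move=> po; apply: ptime_comp po (ptime_expr _ (e := EHd (EReg 0)) _). Qed.

Lemma ptime_tl enc out : ptime P N enc out -> ptime P N enc (fun a => tl (out a)).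
Proof. by move=> po; apply: ptime_comp po (ptime_expr _ (e := ETl (EReg 0)) _). Qed.

End PtimeBasics.
Arguments ptime_id {A P N enc}.
Arguments ptime_const {A P N enc} d.

(** * Boolean operations and finite case distinctions *)

Section PtimeBool.
Context (A : Type) (P : A -> Prop) (N : A -> nat).
Implicit Types enc out : A -> tree.

Lemma ptime_if (b : A -> bool) enc out1 out2 :
  ptime P N enc (fun a => code_bool (b a)) ->
  ptime (fun a => P a /\ b a) N enc out1 ->
  ptime (fun a => P a /\ ~~ b a) N enc out2 ->
  ptime P N enc (fun a => if b a then out1 a else out2 a).
Proof.
move=> pb p1 p2; apply: (ptime_case pb).
  apply: ptime_ext_out (_ : ptime _ _ _ out1).
    by move=> a [_]; case: (b a).
  by apply: ptime_sub p1 => a [Pa]; case: (b a).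
apply: ptime_ext_out (_ : ptime _ _ _ out2).
  by move=> a [_]; case: (b a).
by apply: ptime_sub p2 => a [Pa]; case: (b a).
Qed.

Lemma ptime_negb (b : A -> bool) enc :
  ptime P N enc (fun a => code_bool (b a)) ->
  ptime P N enc (fun a => code_bool (~~ b a)).
Proof.
move=> pb; apply: ptime_ext_out (ptime_if pb (ptime_const (code_bool false))
  (ptime_const (code_bool true))) => a _.
by case: (b a).
Qed.

Lemma ptime_andb (b1 b2 : A -> bool) enc :
  ptime P N enc (fun a => code_bool (b1 a)) ->
  ptime P N enc (fun a => code_bool (b2 a)) ->
  ptime P N enc (fun a => code_bool (b1 a && b2 a)).
Proof.
move=> p1 p2; apply: ptime_ext_out (ptime_if p1 _ (ptime_const (code_bool false))).
  by move=> a _; case: (b1 a).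
by apply: ptime_sub p2 => a [].
Qed.

Lemma ptime_orb (b1 b2 : A -> bool) enc :
  ptime P N enc (fun a => code_bool (b1 a)) ->
  ptime P N enc (fun a => code_bool (b2 a)) ->
  ptime P N enc (fun a => code_bool (b1 a || b2 a)).
Proof.
move=> p1 p2; apply: ptime_ext_out (ptime_if p1 (ptime_const (code_bool true)) _).
  by move=> a _; case: (b1 a).
by apply: ptime_sub p2 => a [].
Qed.
End PtimeBool.

(** [K] is a constant, so the dispatch is a fixed nest of [K] tests, each one cell further down the
    unary code. *)
Lemma ptime_case_nat (A : Type) (P : A -> Prop) (N t : A -> nat) (K : nat)
    (enc out : A -> tree) :
  ptime P N enc (fun a => code_nat (t a)) -> (forall a, P a -> t a < K) ->
  (forall i, i < K -> ptime (fun a => P a /\ t a = i) N enc out) ->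
  ptime P N enc out.
Proof.
elim: K P t => [|K IH] P t pt tK pi.
  by apply: (ptime_expr _ (e := ENil)) => a /tK.
apply: (ptime_case pt).
  apply: (IH _ (fun a => (t a).-1)).
  - apply: ptime_ext_out (ptime_tl (ptime_sub _ pt)) => [a _|a []//].
    by case: (t a).
  - by move=> a [/tK]; case: (t a).
  - move=> i iK; apply: ptime_sub (pi i.+1 iK) => a [[Pa]].
    by case: (t a) => // n _ /= ->.
by apply: ptime_sub (pi 0 isT) => a [Pa]; case: (t a).
Qed.

(** * Loops over lists *)

(** Membership for types without decidable equality, such as formulas over an arbitrary type of
    atoms. *)
Definition occurs (I : Type) (i : I) (l : seq I) : Prop :=
  exists l1 l2, l = l1 ++ i :: l2.

Lemma occursP (I : eqType) (i : I) (l : seq I) : occurs i l <-> i \in l.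
Proof.
split=> [[l1 [l2 ->]]|il]; first by rewrite mem_cat mem_head orbT.
by case/splitPr: il => l1 l2; exists l1, l2.
Qed.

Lemma code_size_occurs (I : Type) (c : I -> tree) (i : I) l :
  occurs i l -> tree_size (c i) < tree_size (code_seq c l).
Proof. by case=> l1 [l2 ->]; elim: l1 => /= [|j l1 IH]; lia. Qed.

Lemma size_code_seq (I : Type) (c : I -> tree) (l : seq I) :
  size l < tree_size (code_seq c l).
Proof. by elim: l => //= i l IH; lia. Qed.

Lemma code_seq_le (I : Type) (c : I -> tree) m (l : seq I) :
  (forall i, occurs i l -> tree_size (c i) <= m) ->
  tree_size (code_seq c l) <= (size l * m.+1).+1.
Proof.
elim: l => //= i l IH h.
have := h i (ex_intro _ [::] (ex_intro _ l erefl)).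
suff: tree_size (code_seq c l) <= (size l * m.+1).+1 by lia.
apply: IH => j [l1 [l2 E]]; apply: h.
by exists (i :: l1), l2; rewrite E.
Qed.

Section Foldl.
Context (A I : Type) (P : A -> Prop) (N : A -> nat) (enc : A -> tree).
Context (l : A -> seq I) (cI : I -> tree).
Hypothesis pl : ptime P N enc (fun a => code_seq cI (l a)).
Hypothesis sl : small P N (fun a => size (l a)).

(** The body has to be fast only at reachable states, where the accumulator is the fold of a prefix
    of the list. Size bounds on the accumulator are derived from this, as the body is timed by [N]
    of the instance alone. *)
Lemma ptime_foldl (S : Type) (s0 : A -> S) (cS : S -> tree) (g : A -> S -> I -> S) :
  ptime P N enc (fun a => cS (s0 a)) ->
  ptime (fun x : A * S * I => P x.1.1 /\ exists l1 l2,
           l x.1.1 = l1 ++ x.2 :: l2 /\ x.1.2 = foldl (g x.1.1) (s0 x.1.1) l1)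
    (fun x => N x.1.1)
    (fun x => Cons (enc x.1.1) (Cons (cS x.1.2) (cI x.2)))
    (fun x => cS (g x.1.1 x.1.2 x.2)) ->
  ptime P N enc (fun a => cS (foldl (g a) (s0 a) (l a))).
Proof.
move=> p0 pg.
pose code a (t : seq I * S) := Cons (enc a) (Cons (code_seq cI t.1) (cS t.2)).
pose next a (t : seq I * S) := if t.1 is i :: r then (r, g a t.2 i) else t.
pose Inv a (t : seq I * S) := exists l1, l a = l1 ++ t.1 /\
  t.2 = foldl (g a) (s0 a) l1.
pose fin a := foldl (g a) (s0 a) (l a).
apply: (ptime_comp (mid := fun a => code a (l a, s0 a))).
  by do ?apply: ptime_cons => //; apply: ptime_id.
apply: (ptime_comp (mid := fun a => code a ([::], fin a))); last first.
  exact: (ptime_expr _ (e := ETl (ETl (EReg 0)))).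
apply: (ptime_while (e := EHd (ETl (EReg 0))) (next := next) (Inv := Inv)
   (mu := fun a t => size t.1)) => //.
- by move=> a Pa; exists [::].
- move=> a [[|i r] s] Pa [l1 /= [E1 E2]] // _; split=> //.
  exists (rcons l1 i); rewrite cat_rcons; split=> //.
  by rewrite -cats1 foldl_cat /= E2.
- pose Q := fun x : A * (seq I * S) => [/\ P x.1, Inv x.1 x.2
    & eval (init (code x.1 x.2)) (EHd (ETl (EReg 0))) <> Nil].
  pose mid := fun x : A * (seq I * S) =>
    Cons (enc x.1) (Cons (cS x.2.2) (hd (code_seq cI x.2.1))).
  have pmid : ptime Q (fun x => N x.1) (fun x => code x.1 x.2) mid.
    exact: (ptime_expr _ (e := ECons (EHd (EReg 0)) (ECons (ETl (ETl (EReg 0)))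
      (EHd (EHd (ETl (EReg 0))))))).
  have pbody : ptime Q (fun x => N x.1) (fun x => code x.1 x.2)
      (fun x => cS (next x.1 x.2).2).
    case: pg => c [t [[k tk] ct]]; apply: ptime_comp pmid _.
    exists c, (fun x => (N x.1).+2 ^ k); split; first by exists k.
    move=> [a [[|i r] s]] [Pa [l1 /= [E1 E2]] //] _.
    have h : P (a, s, i).1.1 /\ exists l1 l2, l (a, s, i).1.1 = l1 ++ (a, s, i).2 :: l2
       /\ (a, s, i).1.2 = foldl (g (a, s, i).1.1) (s0 (a, s, i).1.1) l1.
      by split=> //; exists l1, r.
    have [n [s' [E o le]]] := ct _ h.
    exists n, s'; split=> //; exact: leq_trans le (tk _ h).
  apply: ptime_cons; first exact: (ptime_expr _ (e := EHd (EReg 0))).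
  apply: ptime_cons pbody.
  apply: ptime_ext_out (ptime_tl (ptime_hd (ptime_tl ptime_id))).
  by move=> [a [[|i r] s]].
- move=> a [[|i r] s] Pa [l1 /= [E1 E2]] // _.
  by rewrite /code /fin E1 cats0 E2.
Qed.

Lemma ptime_rev : ptime P N enc (fun a => code_seq cI (rev (l a))).
Proof.
have revE s : rev s = foldl (fun r (i : I) => i :: r) [::] s.
  by elim/last_ind: s => // s i IH; rewrite rev_rcons IH -cats1 foldl_cat.
apply: ptime_ext_out (fun a _ => congr1 (code_seq cI) (revE (l a))) _.
apply: (ptime_foldl (s0 := fun _ => [::]) (cS := code_seq cI) (g := fun _ s i => i :: s)).
  exact: ptime_const Nil.
by apply: (ptime_expr _ (e := ECons (ETl (ETl (EReg 0))) (EHd (ETl (EReg 0))))).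
Qed.
End Foldl.

Section ListClosure.
Context (A I : Type) (P : A -> Prop) (N : A -> nat) (enc : A -> tree).
Context (l : A -> seq I) (cI : I -> tree).
Hypothesis pl : ptime P N enc (fun a => code_seq cI (l a)).
Hypothesis sl : small P N (fun a => size (l a)).

(** A left fold over the reversed list; the reachable accumulators are now the folds of suffixes. *)
Lemma ptime_foldr (S : Type) (s0 : A -> S) (cS : S -> tree) (g : A -> I -> S -> S) :
  ptime P N enc (fun a => cS (s0 a)) ->
  ptime (fun x : A * S * I => P x.1.1 /\ exists l1 l2,
           l x.1.1 = l1 ++ x.2 :: l2 /\ x.1.2 = foldr (g x.1.1) (s0 x.1.1) l2)
    (fun x => N x.1.1)
    (fun x => Cons (enc x.1.1) (Cons (cS x.1.2) (cI x.2)))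
    (fun x => cS (g x.1.1 x.2 x.1.2)) ->
  ptime P N enc (fun a => cS (foldr (g a) (s0 a) (l a))).
Proof.
move=> p0 pg; apply: (ptime_ext_out
  (out := fun a => cS (foldl (fun s i => g a i s) (s0 a) (rev (l a))))).
  by move=> a _; rewrite foldl_rev.
apply: (ptime_foldl (ptime_rev pl sl) _ (g := fun a s i => g a i s)) => //.
  by apply: small_le sl => a _; rewrite size_rev.
apply: ptime_sub pg => -[[a s] i] /= [Pa [l1 [l2 [E ->]]]]; split=> //.
exists (rev l2), (rev l1); rewrite -foldl_rev revK; split=> //.
by rewrite -[LHS]revK E rev_cat rev_cons cat_rcons.
Qed.

(** For bodies of loops over [l a]. The pair with the element can in turn be the instance of an
    inner loop, still timed by the outer [N]. *)
Definition ptime_elem (out : A -> I -> tree) : Prop :=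
  ptime (fun x : A * I => P x.1 /\ occurs x.2 (l x.1)) (fun x => N x.1)
    (fun x => Cons (enc x.1) (cI x.2)) (fun x => out x.1 x.2).

Lemma ptime_elem_acc (S : Type) (Q : A * S * I -> Prop) (cS : S -> tree)
    (out : A -> I -> tree) :
  (forall x, Q x -> P x.1.1 /\ occurs x.2 (l x.1.1)) ->
  ptime_elem out ->
  ptime Q (fun x => N x.1.1)
    (fun x => Cons (enc x.1.1) (Cons (cS x.1.2) (cI x.2)))
    (fun x => out x.1.1 x.2).
Proof.
move=> QP po; apply: (ptime_comp (mid := fun x : A * S * I =>
  Cons (enc x.1.1) (cI x.2))).
  exact: (ptime_expr _ (e := ECons (EHd (EReg 0)) (ETl (ETl (EReg 0))))).
apply: (ptime_reindex (h := fun x : A * S * I => (x.1.1, x.2))) po.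
  by move=> x /QP.
exact: small_id.
Qed.

Lemma ptime_map (J : Type) (cJ : J -> tree) (f : A -> I -> J) :
  ptime_elem (fun a i => cJ (f a i)) ->
  ptime P N enc (fun a => code_seq cJ [seq f a i | i <- l a]).
Proof.
move=> pf; apply: (ptime_foldr (s0 := fun _ => [::]) (cS := code_seq cJ)
  (g := fun a i s => f a i :: s)); first exact: ptime_const Nil.
apply: ptime_cons.
  by apply: ptime_elem_acc pf => x [Px [l1 [l2 [E _]]]]; split; last exists l1, l2.
by apply: (ptime_expr _ (e := EHd (ETl (EReg 0)))).
Qed.

Lemma ptime_filter (p : A -> I -> bool) :
  ptime_elem (fun a i => code_bool (p a i)) ->
  ptime P N enc (fun a => code_seq cI [seq i <- l a | p a i]).
Proof.
move=> pp; apply: (ptime_foldr (s0 := fun _ => [::]) (cS := code_seq cI)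
  (g := fun a i s => if p a i then i :: s else s)); first exact: ptime_const Nil.
apply: (ptime_ext_out (out := fun x : A * seq I * I =>
  if p x.1.1 x.2 then code_seq cI (x.2 :: x.1.2) else code_seq cI x.1.2)).
  by move=> [[a s] i] _ /=; case: (p a i).
apply: ptime_if.
  by apply: ptime_elem_acc pp => x [Px [l1 [l2 [E _]]]]; split; last exists l1, l2.
- by apply: (ptime_expr _ (e := ECons (ETl (ETl (EReg 0))) (EHd (ETl (EReg 0))))).
- by apply: (ptime_expr _ (e := EHd (ETl (EReg 0)))).
Qed.

Lemma ptime_has (p : A -> I -> bool) :
  ptime_elem (fun a i => code_bool (p a i)) ->
  ptime P N enc (fun a => code_bool (has (p a) (l a))).
Proof.
move=> pp; apply: (ptime_foldr (s0 := fun _ => false) (cS := code_bool)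
  (g := fun a i s => p a i || s)); first exact: ptime_const Nil.
apply: ptime_orb.
  by apply: ptime_elem_acc pp => x [Px [l1 [l2 [E _]]]]; split; last exists l1, l2.
by apply: (ptime_expr _ (e := EHd (ETl (EReg 0)))).
Qed.

Lemma ptime_all (p : A -> I -> bool) :
  ptime_elem (fun a i => code_bool (p a i)) ->
  ptime P N enc (fun a => code_bool (all (p a) (l a))).
Proof.
move=> pp; apply: (ptime_foldr (s0 := fun _ => true) (cS := code_bool)
  (g := fun a i s => p a i && s)); first exact: ptime_const (code_bool true).
apply: ptime_andb.
  by apply: ptime_elem_acc pp => x [Px [l1 [l2 [E _]]]]; split; last exists l1, l2.
by apply: (ptime_expr _ (e := EHd (ETl (EReg 0)))).
Qed.

Lemma ptime_cat (l' : A -> seq I) :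
  ptime P N enc (fun a => code_seq cI (l' a)) ->
  ptime P N enc (fun a => code_seq cI (l a ++ l' a)).
Proof.
move=> p'; apply: (ptime_ext_out (out := fun a =>
  code_seq cI (foldr cons (l' a) (l a)))).
  by move=> a _; congr code_seq; elim: (l a) => //= i s ->.
apply: (ptime_foldr (s0 := l') (cS := code_seq cI)
  (g := fun a i s => i :: s)) => //.
by apply: (ptime_expr _ (e := ECons (ETl (ETl (EReg 0))) (EHd (ETl (EReg 0))))).
Qed.
End ListClosure.

(** The loop keeps a flag and a stack of pairs of subtrees still to be compared; a mismatch clears
    the flag and empties the stack. Each round removes at least the root of a first component, so a
    size bound on the first tree bounds the number of rounds. *)
Lemma ptime_asbool_eq (A : Type) (P : A -> Prop) (N : A -> nat)
    (enc out1 out2 : A -> tree) :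
  ptime P N enc out1 -> ptime P N enc out2 ->
  small P N (fun a => tree_size (out1 a)) ->
  ptime P N enc (fun a => code_bool `[< out1 a = out2 a >]).
Proof.
move=> p1 p2 s1.
pose code (a : A) (t : bool * seq (tree * tree)) :=
  Cons (code_bool t.1) (code_seq (fun p => Cons p.1 p.2) t.2).
pose next (a : A) (t : bool * seq (tree * tree)) :=
  match t.2 with
  | (Nil, Nil) :: r => (t.1, r)
  | (Cons d1 d2, Cons d1' d2') :: r => (t.1, (d1, d1') :: (d2, d2') :: r)
  | _ => (false, [::])
  end.
pose Inv a (t : bool * seq (tree * tree)) :=
  t.1 && all (fun p => `[< p.1 = p.2 >]) t.2 = `[< out1 a = out2 a >].
pose mu (a : A) (t : bool * seq (tree * tree)) := sumn [seq tree_size p.1 | p <- t.2].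
apply: (ptime_comp (mid := fun a => code a (true, [:: (out1 a, out2 a)]))).
  apply: ptime_cons; first exact: ptime_const.
  by do ?apply: ptime_cons => //; apply: ptime_const.
apply: (ptime_comp (mid := fun a => code a (`[< out1 a = out2 a >], [::]))); last first.
  exact: (ptime_expr _ (e := EHd (EReg 0))).
have consE d1 d2 d1' d2' : `[< Cons d1 d2 = Cons d1' d2' >] =
    `[< d1 = d1' >] && `[< d2 = d2' >].
  by apply/asboolP/andP => [[-> ->]|[/asboolP-> /asboolP->]]; split; apply/asboolP.
apply: (ptime_while (e := ETl (EReg 0)) (next := next) (Inv := Inv) (mu := mu)) => //.
- by move=> a Pa; rewrite /Inv /= andbT.
- by apply: small_le s1 => a Pa; rewrite /mu /= addn0.
- move=> a [b [|[[|d1 d2] [|d1' d2']] r]] Pa //; rewrite /Inv /mu /= => <- _; split=> //.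
  + by rewrite (introT (asboolP _)).
  + by rewrite asboolF ?andbF.
  + by rewrite asboolF ?andbF.
  + by rewrite consE !andbA.
  + by lia.
- set Q := fun x : A * _ => _.
  pose t1 := EHd (EHd (ETl (EReg 0))); pose t2 := ETl (EHd (ETl (EReg 0))).
  apply: (ptime_case (test := fun x => eval (init (code x.1 x.2)) t1)).
  + exact: ptime_expr.
  + apply: (ptime_case (test := fun x => eval (init (code x.1 x.2)) t2)).
    * exact: ptime_expr.
    * apply: (ptime_expr _ (e := ECons (EHd (EReg 0)) (ECons (ECons (EHd t1) (EHd t2))
        (ECons (ECons (ETl t1) (ETl t2)) (ETl (ETl (EReg 0))))))).
      by move=> [a [b [|[[|d1 d2] [|d1' d2']] r]]] /= [[[_ _ h1] h2] h3].
    * apply: (ptime_expr _ (e := ECons ENil ENil)).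
      by move=> [a [b [|[[|d1 d2] [|d1' d2']] r]]] /= [[[_ _ h1] h2] h3].
  + apply: (ptime_case (test := fun x => eval (init (code x.1 x.2)) t2)).
    * exact: ptime_expr.
    * apply: (ptime_expr _ (e := ECons ENil ENil)).
      by move=> [a [b [|[[|d1 d2] [|d1' d2']] r]]] /= [[[_ _ h1] h2] h3].
    * apply: (ptime_expr _ (e := ECons (EHd (EReg 0)) (ETl (ETl (EReg 0))))).
      by move=> [a [b [|[[|d1 d2] [|d1' d2']] r]]] /= [[[_ _ h1] h2] h3].
- by move=> a [b [|p r]] Pa; rewrite /Inv //= andbT => <-.
Qed.

Lemma ptime_mem (A : Type) (I : eqType) (P : A -> Prop) (N : A -> nat)
    (enc : A -> tree) (cI : I -> tree) (x : A -> I) (l : A -> seq I) :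
  injective cI ->
  ptime P N enc (fun a => cI (x a)) ->
  ptime P N enc (fun a => code_seq cI (l a)) ->
  small P N (fun a => tree_size (cI (x a))) ->
  small P N (fun a => size (l a)) ->
  ptime P N enc (fun a => code_bool (x a \in l a)).
Proof.
move=> inj px pl sx sl.
apply: (ptime_ext_out (out := fun a => code_bool
  (has (fun i => `[< cI (x a) = cI i >]) (l a)))).
  move=> a _; congr code_bool; rewrite -has_pred1; apply: eq_has => i /=.
  by apply/eqP/asboolP => [->|/inj].
apply: (ptime_has pl sl); apply: ptime_asbool_eq.
- apply: (ptime_comp (mid := fun y : A * I => enc y.1)).
    exact: (ptime_expr _ (e := EHd (EReg 0))).
  apply: (ptime_reindex (h := fst)) px; first by move=> y [].
  exact: small_id.
- exact: (ptime_expr _ (e := ETl (EReg 0))).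
- by apply: small_reindex sx => // y [].
Qed.

(** * The teams over a finite set of variables *)

Fixpoint subs (I : Type) (l : seq I) : seq (seq I) :=
  if l is i :: l' then [seq i :: s | s <- subs l'] ++ subs l' else [:: [::]].

Lemma size_subs (I : Type) (l : seq I) : size (subs l) = 2 ^ size l.
Proof. by elim: l => //= i l IH; rewrite size_cat size_map IH expnS; lia. Qed.

Lemma subs_subseq (I : eqType) (l s : seq I) : s \in subs l -> subseq s l.
Proof.
elim: l s => [|i l IH] s /=; first by rewrite inE => /eqP->.
rewrite mem_cat => /orP[/mapP[s' /IH ss' ->]|/IH ss].
  by rewrite /= eqxx.
exact: subseq_trans ss (subseq_cons _ _).
Qed.

Lemma filter_subs (I : eqType) (p : pred I) (l : seq I) : filter p l \in subs l.
Proof.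
elim: l => //= i l IH; rewrite mem_cat; case: (p i); last by rewrite IH orbT.
by rewrite (map_f (cons i) IH).
Qed.

(** An assignment is represented by the list of the variables with their values,
    in a fixed order, and a team by a sublist of the list [rows X] of all
    assignments; teams represented in this way are equal as soon as they have
    the same members. *)
Definition row := seq (var * bool).

Fixpoint rows (X : seq var) : seq row :=
  if X is x :: X' then
    [seq (x, true) :: r | r <- rows X'] ++ [seq (x, false) :: r | r <- rows X']
  else [:: [::]].

Lemma size_rows X : size (rows X) = 2 ^ size X.
Proof. by elim: X => //= x X IH; rewrite size_cat !size_map IH expnS; lia. Qed.

Lemma rows_unzip1 X r : r \in rows X -> unzip1 r = X.
Proof.
by elim: X r => [|x X IH] r /=; [rewrite inE => /eqP-> |
  rewrite mem_cat => /orP[]/mapP[r' /IH <- ->]].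
Qed.

Lemma map_rows (f : var -> bool) X : [seq (x, f x) | x <- X] \in rows X.
Proof.
elim: X => //= x X IH; rewrite mem_cat.
by case: (f x); rewrite (map_f (cons _) IH) // orbT.
Qed.

(** A row over distinct names is the graph of a function, so whether it contains [(x, true)] settles
    both values. *)
Lemma rows_mem X r x b : uniq X -> r \in rows X ->
  (x, b) \in r = (x \in X) && (((x, true) \in r) == b).
Proof.
elim: X r => [|y X IH] r /=; first by rewrite inE => _ /eqP->.
case/andP=> yX uX; rewrite mem_cat.
have memN c r' : r' \in rows X -> (y, c) \notin r'.
  move=> rX; apply: contra yX => yr; rewrite -(rows_unzip1 rX).
  by apply/mapP; exists (y, c).
case/orP=> /mapP[r' rX ->]; rewrite !inE !xpair_eqE.
- case: eqVneq => [->|_] /=; last by rewrite (IH r').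
  by rewrite (negPf (memN b _ rX)) orbF; case: (b).
- case: eqVneq => [->|_] /=; last by rewrite (IH r').
  by rewrite !(negPf (memN _ _ rX)) ?orbF; case: (b).
Qed.

Lemma rows_uniq X : uniq (rows X).
Proof.
elim: X => //= x X IH; rewrite cat_uniq !map_inj_uniq ?IH; try by move=> ? ? [].
rewrite /= andbT; apply/hasPn => r /mapP[r' _ ->].
by apply/mapP => -[].
Qed.

Section Assignments.
Context (X : seq var).
Hypothesis uX : uniq X.
Local Open Scope fset_scope.
Local Open Scope fmap_scope.

Definition row_assignment (r : row) : assignment :=
  [fmap x : [fset x in X] => (val x, true) \in r].

Lemma row_assignment_dom r : domf (row_assignment r) = [fset x in X].
Proof. by []. Qed.

Lemma row_assignmentE r x : (row_assignment r).[? x] =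
  if x \in X then Some ((x, true) \in r) else None.
Proof.
case: ifP => xX; last first.
  have xX' : x \notin domf (row_assignment r) by rewrite row_assignment_dom inE xX.
  by rewrite not_fnd.
have xX' : x \in domf (row_assignment r) by rewrite row_assignment_dom inE.
by rewrite (in_fnd xX') ffunE.
Qed.

(** The bits on the left are those written by [code_table], so the table of a list of rows is
    obtained by dropping the names. *)
Lemma row_assignmentK r : r \in rows X ->
  [seq (x, (row_assignment r).[? x] == Some true) | x <- X] = r.
Proof.
move=> rX; rewrite -[RHS](map_id r) -[X in map _ X](rows_unzip1 rX) -map_comp.
apply/eq_in_map => -[x b] xr /=.
move: (xr); rewrite (rows_mem _ _ uX rX) => /andP[xX /eqP E].
by rewrite row_assignmentE xX E; case: (b).
Qed.

Lemma row_assignment_inj : {in rows X &, injective row_assignment}.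
Proof. by move=> r1 r2 /row_assignmentK{2}<- /row_assignmentK{2}<- ->. Qed.

Lemma row_assignment_onto (t : assignment) : domf t = [fset x in X] ->
  row_assignment [seq (x, t.[? x] == Some true) | x <- X] = t.
Proof.
move=> dt; apply/fmapP => x; rewrite row_assignmentE; case: ifP => xX.
  have xt : x \in domf t by rewrite dt inE.
  have [b tb] : exists b, t.[? x] = Some b by exists t.[xt]; rewrite in_fnd.
  rewrite tb; congr Some; apply/mapP/idP => [[y _ [<-]]|bT].
    by rewrite tb => /esym/eqP[].
  by exists x => //; rewrite tb bT.
have xt : x \notin domf t by rewrite dt inE xX.
by rewrite not_fnd.
Qed.

Definition rows_team (T : seq row) : team :=
  [fset t in [seq row_assignment r | r <- T]].

Lemma rows_teamP T (t : assignment) :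
  reflect (exists2 r, r \in T & t = row_assignment r) (t \in rows_team T).
Proof. by rewrite inE; apply: mapP. Qed.

Lemma mem_rows_team T r : {subset T <= rows X} -> r \in rows X ->
  (row_assignment r \in rows_team T) = (r \in T).
Proof.
move=> TX rX; apply/rows_teamP/idP => [[r' rT /row_assignment_inj->] //|rT].
  exact: TX.
by exists r.
Qed.

Lemma rows_team_over T : team_over [fset x in X] (rows_team T).
Proof. by move=> t /rows_teamP[r _ ->]. Qed.

(** Filtering [rows X] fixes the order, so the result is a member of [subs (rows X)]. *)
Definition team_rows (T : team) : seq row :=
  [seq r <- rows X | row_assignment r \in T].

Lemma team_rowsK (T : team) : team_over [fset x in X] T ->
  rows_team (team_rows T) = T.
Proof.
move=> TX; apply/fsetP => t; apply/rows_teamP/idP => [[r]|tT].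
  by rewrite mem_filter => /andP[rT _] ->.
have tE := row_assignment_onto (TX t tT).
eexists; last exact: esym tE.
by rewrite mem_filter tE tT map_rows.
Qed.
End Assignments.

Lemma subs_rowsP X T : T \in subs (rows X) -> uniq T /\ {subset T <= rows X}.
Proof.
by move=> /subs_subseq sT; split; [apply: subseq_uniq sT (rows_uniq X)|apply: mem_subseq].
Qed.

(** * The satisfying teams of a formula *)

Section Sat.
Context (L : team_logic) (sem : semantics) (X : seq var).
Local Open Scope fset_scope.
Local Open Scope fmap_scope.

Definition literal_sat (x : var) (b : bool) (T : seq row) : bool :=
  all (fun r : row => (x, b) \in r) T.

Definition is_split (T T1 T2 : seq row) : bool :=
  [&& all (fun r => r \in T) T1, all (fun r => r \in T) T2,
      all (fun r => (r \in T1) || (r \in T2)) T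
    & (if sem is strict then false else true) || all (fun r => r \notin T2) T1].

Definition or_sat (S1 S2 : seq (seq row)) (T : seq row) : bool :=
  has (fun T1 => has (fun T2 => is_split T T1 T2) S2) S1.

Let U := subs (rows X).

(** Disjunctions filter [U] instead of forming the unions of all pairs, which
    would let the number of duplicates grow with the depth of the formula. *)
Fixpoint sat_teams (p : formula L) : seq (seq row) :=
  match p with
  | FTop => U
  | FBot => [:: [::]]
  | FVar x => [seq T <- U | literal_sat x true T]
  | FNeg x => [seq T <- U | literal_sat x false T]
  | FAtom a => [seq T <- U | `[< atom_sat (rows_team X T) a >]]
  | FAnd p q => [seq T <- sat_teams p | T \in sat_teams q]
  | FOr p q => [seq T <- U | or_sat (sat_teams p) (sat_teams q) T]
  end.

Lemma sat_teams_sub p : {subset sat_teams p <= U}.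
Proof.
elim: p => [||x|x|a|p IHp q IHq|p IHp q IHq] /=;
  try by apply: mem_subseq; apply: filter_subseq.
- by [].
- move=> T; rewrite inE => /eqP->.
  by have := filter_subs pred0 (rows X); rewrite filter_pred0.
- by move=> T; rewrite mem_filter => /andP[_ /IHp].
Qed.

Lemma size_sat_teams p : size (sat_teams p) <= size U.
Proof.
elim: p => [||x|x|a|p IHp q IHq|p IHp q IHq] /=;
  try by rewrite size_filter count_size.
- by [].
- by rewrite size_subs expn_gt0.
- by rewrite size_filter; apply: leq_trans (count_size _ _) IHp.
Qed.

Hypothesis uX : uniq X.

Lemma literal_satP x b T : x \in X -> T \in U ->
  literal_sat x b T <->
  forall t : assignment, t \in rows_team X T -> t.[? x] = Some b.
Proof.
move=> xX /subs_rowsP[_ TX]; split=> [/allP h t /rows_teamP[r rT ->]|h].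
  move/h: (rT); rewrite (rows_mem _ _ uX (TX _ rT)) => /andP[_ /eqP E].
  by rewrite row_assignmentE xX E.
apply/allP => r rT; rewrite (rows_mem _ _ uX (TX _ rT)) xX.
have /h : row_assignment X r \in rows_team X T by apply/rows_teamP; exists r.
by rewrite row_assignmentE xX => -[->]; rewrite /= eqxx.
Qed.

Lemma is_splitP T T1 T2 : T \in U -> T1 \in U -> T2 \in U ->
  is_split T T1 T2 <->
  rows_team X T = rows_team X T1 `|` rows_team X T2 /\
  (sem = strict -> rows_team X T1 `&` rows_team X T2 = fset0).
Proof.
move=> /subs_rowsP[_ TX] /subs_rowsP[_ TX1] /subs_rowsP[_ TX2].
split=> [/and4P[/allP h1 /allP h2 /allP h3 h4]|[E1 E2]].
  split.
    apply/fsetP => t; rewrite in_fsetU; apply/idP/orP => [/rows_teamP[r rT ->]|].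
      have := h3 _ rT; rewrite !(mem_rows_team uX) ?TX //.
      by move/orP.
    by case=> /rows_teamP[r rT ->]; apply/rows_teamP; exists r; auto.
  move=> sE; move: h4; rewrite sE /= => /allP h4.
  apply/fsetP => t; rewrite in_fsetI in_fset0; apply/negbTE/negP => /andP[].
  move=> /rows_teamP[r rT ->]; rewrite (mem_rows_team uX) ?TX1 //.
  exact/negP/h4.
have memE r : r \in rows X -> (r \in T) = (r \in T1) || (r \in T2).
  move=> rX; rewrite -(mem_rows_team uX TX rX) -(mem_rows_team uX TX1 rX).
  by rewrite -(mem_rows_team uX TX2 rX) E1 in_fsetU.
apply/and4P; split.
- by apply/allP => r rT; rewrite memE ?rT ?TX1.
- by apply/allP => r rT; rewrite memE ?rT ?orbT ?TX2.
- by apply/allP => r rT; rewrite -memE ?TX.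
case sE: sem E2 => //= /(_ erefl)/fsetP E2; apply/allP => r rT1; apply/negP => rT2.
have := E2 (row_assignment X r).
by rewrite in_fsetI in_fset0 !(mem_rows_team uX) ?rT1 ?rT2 ?TX1.
Qed.

(** An inclusion and not an equality, because subformulas are evaluated on teams over the variables
    of the whole formula. *)
Lemma sat_teamsP p T : T \in U -> formula_vars p `<=` [fset x in X] ->
  T \in sat_teams p <-> sat sem (rows_team X T) p.
Proof.
elim: p T => [||x|x|a|p IHp q IHq|p IHp q IHq] T TU /=.
- by rewrite TU.
- rewrite inE => _; split=> [/eqP->|].
    by apply/fsetP => t; apply/rows_teamP; rewrite in_fset0; case.
  case: T TU => [//|r T] _ /fsetP/(_ (row_assignment X r)).
  rewrite in_fset0 => /rows_teamP[]; exists r => //; exact: mem_head.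
- rewrite fsub1set inE mem_filter TU andbT => xX; exact: literal_satP.
- rewrite fsub1set inE mem_filter TU andbT => xX; exact: literal_satP.
- by rewrite mem_filter TU andbT => _; split=> /asboolP.
- rewrite fsubUset => /andP[pX qX]; rewrite mem_filter.
  by split=> [/andP[/(IHq T TU qX) ? /(IHp T TU pX)]|
    [/(IHp T TU pX) -> /(IHq T TU qX) ->]].
rewrite fsubUset mem_filter TU andbT => /andP[pX qX]; split.
  move=> /hasP[T1 Tp /hasP[T2 Tq sp]].
  have TU1 := sat_teams_sub Tp; have TU2 := sat_teams_sub Tq.
  have [E1 E2] := (is_splitP TU TU1 TU2).1 sp.
  exists (rows_team X T1), (rows_team X T2).
  by split=> //; [apply/(IHp T1)|apply/(IHq T2)].
move=> [T1 [T2 [E1 E2 s1 s2]]].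
(* The parts of a team over [X] are again over [X], hence represented in [U]. *)
have ov : team_over [fset x in X] (T1 `|` T2) by rewrite -E1; apply: rows_team_over.
have ov1 : team_over [fset x in X] T1 by move=> t tT; apply: ov; rewrite in_fsetU tT.
have ov2 : team_over [fset x in X] T2 by move=> t tT; apply: ov; rewrite in_fsetU tT orbT.
have TU1 : team_rows X T1 \in U by apply: filter_subs.
have TU2 : team_rows X T2 \in U by apply: filter_subs.
apply/hasP; exists (team_rows X T1); first by apply/(IHp _ TU1 pX); rewrite team_rowsK.
apply/hasP; exists (team_rows X T2); first by apply/(IHq _ TU2 qX); rewrite team_rowsK.
by apply/(is_splitP TU TU1 TU2); rewrite !team_rowsK.
Qed.

Lemma satisfiableP p : formula_vars p = [fset x in X] ->
  satisfiable sem p <-> has (fun T => T != [::]) (sat_teams p).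
Proof.
move=> pX; have sub : formula_vars p `<=` [fset x in X] by rewrite pX.
split=> [[T [T0]]|/hasP[T Tp T0]].
  rewrite pX => TX sT; have TU : team_rows X T \in U by apply: filter_subs.
  apply/hasP; exists (team_rows X T); first by apply/sat_teamsP; rewrite ?team_rowsK.
  apply: contra T0 => /eqP E; rewrite -(team_rowsK TX) E.
  by apply/eqP/fsetP => t; apply/rows_teamP; rewrite in_fset0; case.
exists (rows_team X T); split; last by have := (sat_teamsP (sat_teams_sub Tp) sub).1 Tp.
- apply/fset0Pn; case: T T0 {Tp} => // r T _; exists (row_assignment X r).
  by apply/rows_teamP; exists r; rewrite ?mem_head.
- by rewrite pX; apply: rows_team_over.
Qed.
End Sat.

(** * Traversing a formula *)

(** The syntax trees of atoms are traversed too, since their variables count as variables of the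
    formula. *)
Variant node (L : team_logic) := NForm (p : formula L) | NSyn (s : syn).
Arguments NSyn {L} s.

Section Nodes.
Context (L : team_logic).
Implicit Types (p : formula L) (n : node L).
Local Open Scope fset_scope.

(** The tags of [code_formula] and [code_syn] overlap; the leading 1 or 0 tells the two kinds
    apart. *)
Definition code_node n : tree :=
  match n with
  | NForm p => Cons (code_nat 1) (code_formula p)
  | NSyn s => Cons (code_nat 0) (code_syn s)
  end.

Definition node_tag n : nat :=
  match n with
  | NSyn (SVar _) => 0
  | NSyn (SSym _) => 1
  | NSyn (SUn _ _) => 2
  | NSyn (SBin _ _ _) => 3
  | NForm (FTop) => 4
  | NForm (FBot) => 5
  | NForm (FVar _) => 6
  | NForm (FNeg _) => 7
  | NForm (FAtom _) => 8
  | NForm (FAnd _ _) => 9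
  | NForm (FOr _ _) => 10
  end.

Lemma ptime_case_node (A : Type) (P : A -> Prop) (N : A -> nat)
    (n : A -> node L) (enc out : A -> tree) :
  ptime P N enc (fun a => code_node (n a)) ->
  (forall i, i < 11 -> ptime (fun a => P a /\ node_tag (n a) = i) N enc out) ->
  ptime P N enc out.
Proof.
move=> pn pi.
have ptag Q : (forall a, Q a -> P a) ->
    ptime Q N enc (fun a => hd (tl (code_node (n a)))).
  by move=> QP; apply/ptime_hd/ptime_tl/(ptime_sub QP).
apply: (ptime_case_nat (t := fun a => if n a is NForm _ then 1 else 0) (K := 2)).
- by apply: ptime_ext_out (ptime_hd pn) => a _; case: (n a).
- by move=> a _; case: (n a).
move=> [|[|//]] _.
- apply: (ptime_case_nat (t := fun a => node_tag (n a)) (K := 4)).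
  + apply: ptime_ext_out (ptag _ _) => [a [_]|a []//].
    by case: (n a) => // -[].
  + by move=> a [_]; case: (n a) => // -[].
  + move=> i i4; apply: ptime_sub (pi i (leq_trans i4 _)) => // a [[]].
    by [].
- apply: (ptime_case_nat (t := fun a => node_tag (n a) - 4) (K := 7)).
  + apply: ptime_ext_out (ptag _ _) => [a [_]|a []//].
    by case: (n a) => // -[].
  + by move=> a [_]; case: (n a) => // -[].
  + move=> i i7; have i11 : i + 4 < 11 by lia.
    apply: ptime_sub (pi _ i11) => a [[Pa]].
    by case: (n a) => // -[] //= *; split=> //; lia.
Qed.

(** The right child comes first: the traversal stacks the children in this order
    and conses each visited node to its result, which ends up in postorder. *)
Definition children n : seq (node L) :=
  match n with
  | NForm (FAtom a) => [:: NSyn (atom_syn a)]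
  | NForm (FAnd p q) | NForm (FOr p q) => [:: NForm q; NForm p]
  | NSyn (SUn _ s) => [:: NSyn s]
  | NSyn (SBin _ s1 s2) => [:: NSyn s2; NSyn s1]
  | _ => [::]
  end.

Fixpoint syn_nodes (s : syn) : seq (node L) :=
  match s with
  | SUn _ s1 => syn_nodes s1
  | SBin _ s1 s2 => syn_nodes s1 ++ syn_nodes s2
  | _ => [::]
  end ++ [:: NSyn s].

Fixpoint formula_nodes p : seq (node L) :=
  match p with
  | FAtom a => syn_nodes (atom_syn a)
  | FAnd p1 p2 | FOr p1 p2 => formula_nodes p1 ++ formula_nodes p2
  | _ => [::]
  end ++ [:: NForm p].

Definition nodes n : seq (node L) :=
  match n with NForm p => formula_nodes p | NSyn s => syn_nodes s end.

(** The part of the postorder list that the stack has yet to produce. The output grows from its end,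
    so the top of the stack contributes the last segment. *)
Definition stack_nodes (st : seq (node L)) : seq (node L) :=
  flatten (rev (map nodes st)).

Lemma stack_nodes_cat st1 st2 :
  stack_nodes (st1 ++ st2) = stack_nodes st2 ++ stack_nodes st1.
Proof. by rewrite /stack_nodes map_cat rev_cat flatten_cat. Qed.

Lemma stack_nodes1 n : stack_nodes [:: n] = nodes n.
Proof. by rewrite /stack_nodes /= cats0. Qed.

Lemma nodesE n : nodes n = stack_nodes (children n) ++ [:: n].
Proof.
by case: n => [[||?|?|?|? ?|? ?]|[?|?|? ?|? ? ?]]; rewrite //= /stack_nodes /= ?cats0.
Qed.

Lemma size_syn_nodes s : size (syn_nodes s) <= tree_size (code_syn s).
Proof. by elim: s => [x|a|a s IH|a s1 IH1 s2 IH2] /=; rewrite ?size_cat /=; lia. Qed.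

Lemma size_formula_nodes p : size (formula_nodes p) <= tree_size (code_formula p).
Proof.
elim: p => [||x|x|a|p IHp q IHq|p IHp q IHq] /=; rewrite ?size_cat /=; try lia.
have := size_syn_nodes (atom_syn a); lia.
Qed.

(** Depth-first search with an explicit stack replaces recursion; every later pass over the formula
    is a fold over this list. The measure is the number of nodes still to be produced. *)
Lemma ptime_nodes (A : Type) (P : A -> Prop) (N : A -> nat) (p : A -> formula L) :
  small P N (fun a => tree_size (code_formula (p a))) ->
  ptime P N (fun a => code_formula (p a))
    (fun a => code_seq code_node (formula_nodes (p a))).
Proof.
move=> sp.
pose code (a : A) (t : seq (node L) * seq (node L)) :=
  Cons (code_seq code_node t.1) (code_seq code_node t.2).
pose next (a : A) (t : seq (node L) * seq (node L)) :=
  if t.1 is n :: st then (children n ++ st, n :: t.2) else t.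
pose Inv a (t : seq (node L) * seq (node L)) :=
  stack_nodes t.1 ++ t.2 = formula_nodes (p a).
pose mu (a : A) (t : seq (node L) * seq (node L)) := size (stack_nodes t.1).
apply: (ptime_comp (mid := fun a => code a ([:: NForm (p a)], [::]))).
  pose root := ECons (ECons ENil ENil) (EReg 0).
  by apply: (ptime_expr _ (e := ECons (ECons root ENil) ENil)).
apply: (ptime_comp (mid := fun a => code a ([::], formula_nodes (p a)))); last first.
  exact: (ptime_expr _ (e := ETl (EReg 0))).
apply: (ptime_while (e := EHd (EReg 0)) (next := next) (Inv := Inv) (mu := mu)) => //.
- by move=> a Pa; rewrite /Inv /= stack_nodes1 cats0.
- apply: small_le sp => a Pa; rewrite /mu /= stack_nodes1.
  exact: size_formula_nodes.
- move=> a [[|n st] done] Pa //; rewrite /Inv /mu /next /= -cat1s => <- _.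
  rewrite !stack_nodes_cat stack_nodes1 nodesE !size_cat /= addn1 addnS leqnn.
  by rewrite -!catA.
- set Q := fun x : A * _ => _.
  apply: (ptime_case_node (n := fun x => head (NSyn (SVar [::])) x.2.1)).
    apply: (ptime_expr _ (e := EHd (EHd (EReg 0)))).
    by move=> [a [[|n st] done]] [].
  (* [args] skips the kind and the tag of the node; [stk i] is the new stack after popping a node
     whose [node_tag] is [i]. *)
  pose nd := EHd (EHd (EReg 0)); pose args := ETl (ETl nd).
  pose rest := ETl (EHd (EReg 0)).
  pose pushF e r := ECons (ECons (ECons ENil ENil) e) r.
  pose pushS e r := ECons (ECons ENil e) r.
  pose stk i := nth rest [:: rest; rest; pushS (ETl args) rest;
    pushS (ETl (ETl args)) (pushS (EHd (ETl args)) rest); rest; rest; rest; rest;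
    pushS args rest; pushF (ETl args) (pushF (EHd args) rest);
    pushF (ETl args) (pushF (EHd args) rest)] i.
  move=> i _; apply: (ptime_expr _ (e := ECons (stk i) (ECons nd (ETl (EReg 0))))).
  move=> [a [[|n st] done]] [[_ _ //] _] /= <-.
  by case: n => [[||?|?|?|? ?|? ?]|[?|?|? ?|? ? ?]].
- by move=> a [[|n st] done] Pa; rewrite /Inv //= => <-.
Qed.

(** * The variables of a formula *)

Definition node_var n : option var :=
  match n with
  | NForm (FVar x) | NForm (FNeg x) | NSyn (SVar x) => Some x
  | _ => None
  end.

Definition add_var (X : seq var) n : seq var :=
  if node_var n is Some x then if x \in X then X else x :: X else X.

Definition var_seq p : seq var := foldl add_var [::] (formula_nodes p).

Lemma add_vars_uniq X l : uniq X -> uniq (foldl add_var X l).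
Proof.
elim: l X => //= n l IH X uX; apply: IH; rewrite /add_var.
by case: (node_var n) => // x; case: ifP => //= ->.
Qed.

Lemma mem_add_vars X l x :
  (x \in foldl add_var X l) = (x \in X) || has (fun n => node_var n == Some x) l.
Proof.
elim: l X => [|n l IH] X /=; first by rewrite orbF.
rewrite IH orbA; congr (_ || _); rewrite /add_var.
case: (node_var n) => [y|]; last by rewrite orbF.
have -> : (Some y == Some x) = (x == y) by apply/eqP/eqP => [[->]|->].
case: ifP => yX; rewrite ?inE; last exact: orbC.
by case: eqVneq => [->|]; rewrite ?yX ?orbF.
Qed.

Lemma size_add_vars X l : size (foldl add_var X l) <= size X + size l.
Proof.
elim: l X => [|n l IH] X /=; first by rewrite addn0.
apply: leq_trans (IH _) _; rewrite /add_var.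
by case: (node_var n) => [x|]; [case: ifP|] => /=; lia.
Qed.

Lemma has_syn_vars s x :
  has (fun n => node_var n == Some x) (syn_nodes s) = (x \in syn_vars s).
Proof.
elim: s => [y|a|a s IH|a s1 IH1 s2 IH2] /=;
  rewrite ?has_cat /= ?orbF ?inE ?IH ?IH1 ?IH2 //.
by apply/eqP/eqP => [[->]|->].
Qed.

Lemma has_formula_vars p x :
  has (fun n => node_var n == Some x) (formula_nodes p) = (x \in formula_vars p).
Proof.
elim: p => [||y|y|a|p IHp q IHq|p IHp q IHq] /=;
  rewrite ?has_cat /= ?orbF ?inE ?has_syn_vars ?IHp ?IHq //;
  by apply/eqP/eqP => [[->]|->].
Qed.

Lemma var_seq_uniq p : uniq (var_seq p).
Proof. exact: add_vars_uniq. Qed.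

Lemma mem_var_seq p x : (x \in var_seq p) = (x \in formula_vars p).
Proof. by rewrite mem_add_vars /= has_formula_vars. Qed.

Lemma formula_varsE p : formula_vars p = [fset x in var_seq p].
Proof. by apply/fsetP => x; rewrite inE mem_var_seq. Qed.

Lemma size_var_seq p : size (var_seq p) = variables p.
Proof. by rewrite /variables formula_varsE card_fseq undup_id ?var_seq_uniq. Qed.

Lemma code_syn_var s x : x \in syn_vars s ->
  tree_size (code_word x) <= tree_size (code_syn s).
Proof.
elim: s => [y|a|a s IH|a s1 IH1 s2 IH2] /=; rewrite ?inE.
- by move/eqP->; lia.
- by [].
- by move/IH; lia.
- by case/orP=> [/IH1|/IH2]; lia.
Qed.

Lemma code_formula_var p x : x \in formula_vars p ->
  tree_size (code_word x) <= tree_size (code_formula p).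
Proof.
elim: p => [||y|y|a|p IHp q IHq|p IHp q IHq] /=; rewrite ?inE //.
- by move/eqP->; lia.
- by move/eqP->; lia.
- by move/code_syn_var; lia.
- by case/orP=> [/IHp|/IHq]; lia.
- by case/orP=> [/IHp|/IHq]; lia.
Qed.
End Nodes.

(** * Injectivity of the codes and extraction of the variables *)

Lemma code_seq_inj (I : Type) (c : I -> tree) : injective c -> injective (code_seq c).
Proof. by move=> ci; elim=> [|x s IH] [|y t] //= [/ci-> /IH->]. Qed.

Lemma code_bool_inj : injective code_bool.
Proof. by case=> -[]. Qed.

Lemma code_word_inj : injective code_word.
Proof. exact: code_seq_inj code_bool_inj. Qed.

Lemma ptime_var_seq (L : team_logic) (A : Type) (P : A -> Prop) (N : A -> nat)
    (enc : A -> tree) (p : A -> formula L) :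
  small P N (fun a => tree_size (code_formula (p a))) ->
  ptime P N enc (fun a => code_seq (@code_node L) (formula_nodes (p a))) ->
  ptime P N enc (fun a => code_seq code_word (var_seq (p a))).
Proof.
move=> sp pn.
have sn : small P N (fun a => size (formula_nodes (p a))).
  by apply: small_le sp => a _; apply: size_formula_nodes.
apply: (ptime_foldl pn sn (s0 := fun _ => [::]) (g := fun _ => @add_var L)).
  exact: ptime_const Nil.
set Q := fun x : A * seq var * node L => _.
apply: (ptime_case_node (n := snd)).
  exact: (ptime_expr _ (e := ETl (ETl (EReg 0)))).
have keep (R : A * seq var * node L -> Prop) : (forall x, R x -> node_var x.2 = None) ->
    ptime R (fun x => N x.1.1)
      (fun x => Cons (enc x.1.1) (Cons (code_seq code_word x.1.2) (code_node x.2)))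
      (fun x => code_seq code_word (add_var x.1.2 x.2)).
  move=> RN; apply: (ptime_expr _ (e := EHd (ETl (EReg 0)))) => -[[a X] n] /RN /= E.
  by rewrite /add_var E.
have add (R : A * seq var * node L -> Prop) : (forall x, R x -> Q x /\
      exists2 y, node_var x.2 = Some y & tl (tl (code_node x.2)) = code_word y) ->
    ptime R (fun x => N x.1.1)
      (fun x => Cons (enc x.1.1) (Cons (code_seq code_word x.1.2) (code_node x.2)))
      (fun x => code_seq code_word (add_var x.1.2 x.2)).
  move=> RS.
  have py : ptime R (fun x => N x.1.1)
      (fun x => Cons (enc x.1.1) (Cons (code_seq code_word x.1.2) (code_node x.2)))
      (fun x => code_word (odflt [::] (node_var x.2))).
    apply: (ptime_expr _ (e := ETl (ETl (ETl (ETl (EReg 0)))))).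
    by move=> x /RS[_ [y E1 E2]] /=; rewrite E1 E2.
  have pX (R' : A * seq var * node L -> Prop) : ptime R' (fun x => N x.1.1)
      (fun x => Cons (enc x.1.1) (Cons (code_seq code_word x.1.2) (code_node x.2)))
      (fun x => code_seq code_word x.1.2).
    exact: (ptime_expr _ (e := EHd (ETl (EReg 0)))).
  apply: (ptime_ext_out (out := fun x : A * seq var * node L =>
    if odflt [::] (node_var x.2) \in x.1.2 then code_seq code_word x.1.2 else
    Cons (code_word (odflt [::] (node_var x.2))) (code_seq code_word x.1.2))).
    by move=> x /RS[_ [y E _]]; rewrite /add_var E /=; case: ifP.
  apply: ptime_if => //.
  - apply: ptime_mem.
    + exact: code_word_inj.
    + exact: py.
    + exact: pX.
    + apply: (small_le (g := fun x => tree_size (code_formula (p x.1.1)))).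
        move=> x /RS[[Pa [l1 [l2 [E _]]]] [y Ey _]].
        apply: code_formula_var; rewrite -has_formula_vars E has_cat /= Ey /=.
        by rewrite eqxx orbT.
      by apply: small_reindex sp => // x /RS[[]].
    + apply: (small_le (g := fun x => size (formula_nodes (p x.1.1)))).
        move=> x /RS[[Pa [l1 [l2 [E ->]]]] _].
        by rewrite E size_cat (leq_trans (size_add_vars _ _)) // leq_addr.
      by apply: small_reindex sn => // x /RS[[]].
  - by apply: ptime_cons => //; apply: ptime_sub py => x [].
move=> i _.
(* The tags of [SVar], [FVar] and [FNeg]. *)
have [i1|i1] := boolP (i \in [:: 0; 6; 7]).
  apply: add => -[[a X] n] [Qx tg]; split=> //; move: i1; rewrite -tg {Qx tg} /=.
  by case: n => [[||y|y|?|? ?|? ?]|[y|?|? ?|? ? ?]] // _; exists y.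
apply: keep => -[[a X] n] [_ tg]; move: i1; rewrite -tg /=.
by case: n {tg} => [[||y|y|?|? ?|? ?]|[y|?|? ?|? ? ?]].
Qed.

(** * Computing the satisfying teams *)

Definition code_row : row -> tree :=
  code_seq (fun e : var * bool => Cons (code_word e.1) (code_bool e.2)).

Definition code_rows : seq row -> tree := code_seq code_row.

Lemma code_entry_inj :
  injective (fun e : var * bool => Cons (code_word e.1) (code_bool e.2)).
Proof. by move=> [x b] [y c] [/code_word_inj-> /code_bool_inj->]. Qed.

Lemma code_row_inj : injective code_row.
Proof. exact: code_seq_inj code_entry_inj. Qed.

Lemma code_rows_inj : injective code_rows.
Proof. exact: code_seq_inj code_row_inj. Qed.

Section Elem.
Context (A I : Type) (P : A -> Prop) (N : A -> nat) (enc : A -> tree).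
Context (l : A -> seq I) (cI : I -> tree).

Lemma ptime_elem_env (out : A -> tree) :
  ptime P N enc out -> ptime_elem P N enc l cI (fun a _ => out a).
Proof.
move=> po; apply: (ptime_comp (mid := fun y : A * I => enc y.1)).
  exact: (ptime_expr _ (e := EHd (EReg 0))).
apply: (ptime_reindex (h := fst)) po; first by move=> y [].
exact: small_id.
Qed.

Lemma ptime_elem_id : ptime_elem P N enc l cI (fun _ i => cI i).
Proof. exact: (ptime_expr _ (e := ETl (EReg 0))). Qed.

Lemma small_elem_env (f : A -> nat) : small P N f ->
  small (fun x : A * I => P x.1 /\ occurs x.2 (l x.1)) (fun x => N x.1)
    (fun x => f x.1).
Proof. by move=> sf; apply: (small_reindex (h := fst)) sf => // x []. Qed.

Lemma small_elem : small P N (fun a => tree_size (code_seq cI (l a))) ->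
  small (fun x : A * I => P x.1 /\ occurs x.2 (l x.1)) (fun x => N x.1)
    (fun x => tree_size (cI x.2)).
Proof.
move=> /small_elem_env; apply: small_le => x [_ /(code_size_occurs cI)].
exact: ltnW.
Qed.

Lemma small_size_code : small P N (fun a => tree_size (code_seq cI (l a))) ->
  small P N (fun a => size (l a)).
Proof. by apply: small_le => a _; apply/ltnW/size_code_seq. Qed.
End Elem.

Lemma small_expn2 (A : Type) (P : A -> Prop) (N f : A -> nat) :
  small P N (fun a => 2 ^ f a) -> small P N f.
Proof. by apply: small_le => a _; apply/ltnW/ltn_expl. Qed.

Lemma ptime_cons_all (A I : Type) (P : A -> Prop) (N : A -> nat)
    (enc : A -> tree) (cI : I -> tree) (i : A -> I) (l : A -> seq (seq I)) :
  ptime P N enc (fun a => cI (i a)) ->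
  ptime P N enc (fun a => code_seq (code_seq cI) (l a)) ->
  small P N (fun a => size (l a)) ->
  ptime P N enc (fun a => code_seq (code_seq cI) [seq i a :: s | s <- l a]).
Proof.
move=> pi pl sl; apply: (ptime_map pl sl (f := fun a s => i a :: s)).
exact: ptime_cons (ptime_elem_env _ _ pi) (ptime_elem_id _ _ _ _ _).
Qed.

(** At a reachable state the accumulator is [subs] of a suffix, so it is never longer than the final
    list, whose length is small by hypothesis. *)
Lemma ptime_subs (A I : Type) (P : A -> Prop) (N : A -> nat) (enc : A -> tree)
    (cI : I -> tree) (l : A -> seq I) :
  ptime P N enc (fun a => code_seq cI (l a)) ->
  small P N (fun a => 2 ^ size (l a)) ->
  ptime P N enc (fun a => code_seq (code_seq cI) (subs (l a))).
Proof.
move=> pl sl.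
have subsE (s : seq I) : subs s =
    foldr (fun i R => [seq i :: r | r <- R] ++ R) [:: [::]] s.
  by elim: s => //= i s ->.
apply: (ptime_ext_out (out := fun a => code_seq (code_seq cI)
  (foldr (fun i R => [seq i :: r | r <- R] ++ R) [:: [::]] (l a)))).
  by move=> a _; rewrite subsE.
apply: (ptime_foldr pl (small_expn2 sl) (s0 := fun _ => [:: [::]])
  (g := fun _ i R => [seq i :: r | r <- R] ++ R)).
  exact: ptime_const (Cons Nil Nil).
set Q := fun x : A * seq (seq I) * I => _.
have sR : small Q (fun x => N x.1.1) (fun x => size x.1.2).
  apply: (small_le (g := fun x => 2 ^ size (l x.1.1))).
    move=> [[a R] i]; rewrite /Q /= => -[_ [l1 [l2 [-> ->]]]].
    rewrite -subsE size_subs leq_exp2l // size_cat /=; lia.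
  by apply: (small_reindex (h := fun x : A * seq (seq I) * I => x.1.1)) sl => // x [].
have pR : ptime Q (fun x => N x.1.1)
    (fun x => Cons (enc x.1.1) (Cons (code_seq (code_seq cI) x.1.2) (cI x.2)))
    (fun x => code_seq (code_seq cI) x.1.2).
  exact: (ptime_expr _ (e := EHd (ETl (EReg 0)))).
apply: ptime_cat => //.
- apply: ptime_cons_all => //.
  exact: (ptime_expr _ (e := ETl (ETl (EReg 0)))).
- by apply: small_le sR => x _; rewrite size_map.
Qed.

Lemma ptime_rows (A : Type) (P : A -> Prop) (N : A -> nat) (enc : A -> tree)
    (X : A -> seq var) :
  ptime P N enc (fun a => code_seq code_word (X a)) ->
  small P N (fun a => 2 ^ size (X a)) ->
  ptime P N enc (fun a => code_rows (rows (X a))).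
Proof.
move=> pl sl.
pose step x (R : seq row) :=
  [seq (x, true) :: r | r <- R] ++ [seq (x, false) :: r | r <- R].
have rowsE s : rows s = foldr step [:: [::]] s by elim: s => //= i s ->.
apply: (ptime_ext_out (out := fun a => code_rows (foldr step [:: [::]] (X a)))).
  by move=> a _; rewrite rowsE.
apply: (ptime_foldr pl (small_expn2 sl) (s0 := fun _ => [:: [::]])
  (g := fun _ => step)).
  exact: ptime_const (Cons Nil Nil).
set Q := fun x : A * seq row * var => _.
have sR : small Q (fun x => N x.1.1) (fun x => size x.1.2).
  apply: (small_le (g := fun x => 2 ^ size (X x.1.1))).
    move=> [[a R] i]; rewrite /Q /= => -[_ [l1 [l2 [-> ->]]]].
    rewrite -rowsE size_rows leq_exp2l // size_cat /=; lia.
  by apply: (small_reindex (h := fun x : A * seq row * var => x.1.1)) sl => // x [].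
have pR : ptime Q (fun x => N x.1.1)
    (fun x => Cons (enc x.1.1) (Cons (code_rows x.1.2) (code_word x.2)))
    (fun x => code_rows x.1.2).
  exact: (ptime_expr _ (e := EHd (ETl (EReg 0)))).
have pe b : ptime Q (fun x => N x.1.1)
    (fun x => Cons (enc x.1.1) (Cons (code_rows x.1.2) (code_word x.2)))
    (fun x => code_seq code_row [seq (x.2, b) :: r | r <- x.1.2]).
  apply: (ptime_cons_all (i := fun x : A * seq row * var => (x.2, b))) => //.
  apply: ptime_cons (ptime_const _).
  exact: (ptime_expr _ (e := ETl (ETl (EReg 0)))).
apply: ptime_cat => //.
by apply: small_le sR => x _; rewrite size_map.
Qed.

(** * Deciding literals, splits and disjunctions *)

Section Tests.
Context (A : Type) (P : A -> Prop) (N : A -> nat) (enc : A -> tree).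

Lemma ptime_literal (x : A -> var) (b : bool) (T : A -> seq row) :
  ptime P N enc (fun a => code_word (x a)) ->
  ptime P N enc (fun a => code_rows (T a)) ->
  small P N (fun a => tree_size (code_word (x a))) ->
  small P N (fun a => tree_size (code_rows (T a))) ->
  ptime P N enc (fun a => code_bool (literal_sat (x a) b (T a))).
Proof.
move=> px pT sx sT.
apply: (ptime_all pT (small_size_code sT) (p := fun a r => (x a, b) \in r)).
apply: (ptime_mem (x := fun y : A * row => (x y.1, b))).
- exact: code_entry_inj.
- exact: ptime_cons (ptime_elem_env _ _ px) (ptime_const _).
- exact: ptime_elem_id.
- apply: (small_le (g := fun y => tree_size (code_word (x y.1)) + 4)).
    by move=> y _; case: (b) => /=; lia.
  exact: small_add (small_elem_env _ sx) (small_const _ _ _).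
- exact: small_size_code (small_elem sT).
Qed.

Lemma ptime_mem_rows (r : A -> row) (T : A -> seq row) :
  ptime P N enc (fun a => code_row (r a)) ->
  ptime P N enc (fun a => code_rows (T a)) ->
  small P N (fun a => tree_size (code_row (r a))) ->
  small P N (fun a => tree_size (code_rows (T a))) ->
  ptime P N enc (fun a => code_bool (r a \in T a)).
Proof.
move=> pr pT sr sT.
exact: ptime_mem code_row_inj pr pT sr (small_size_code sT).
Qed.
End Tests.

Section Splits.
Context (A : Type) (P : A -> Prop) (N : A -> nat) (enc : A -> tree).

Lemma ptime_is_split sem (T T1 T2 : A -> seq row) :
  ptime P N enc (fun a => code_rows (T a)) ->
  ptime P N enc (fun a => code_rows (T1 a)) ->
  ptime P N enc (fun a => code_rows (T2 a)) ->
  small P N (fun a => tree_size (code_rows (T a))) ->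
  small P N (fun a => tree_size (code_rows (T1 a))) ->
  small P N (fun a => tree_size (code_rows (T2 a))) ->
  ptime P N enc (fun a => code_bool (is_split sem (T a) (T1 a) (T2 a))).
Proof.
move=> p p1 p2 s s1 s2.
have memE T' T'' : ptime P N enc (fun a => code_rows (T' a)) ->
    small P N (fun a => tree_size (code_rows (T' a))) ->
    ptime P N enc (fun a => code_rows (T'' a)) ->
    small P N (fun a => tree_size (code_rows (T'' a))) ->
    ptime_elem P N enc T' code_row (fun a r => code_bool (r \in T'' a)).
  move=> p' s' p'' s''.
  apply: ptime_mem_rows (ptime_elem_env _ _ p'') _ (small_elem_env _ s'').
    exact: ptime_elem_id.
  exact: small_elem s'.
apply: ptime_andb; last apply: ptime_andb; last apply: ptime_andb.
- by apply: (ptime_all p1 (small_size_code s1)); apply: memE.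
- by apply: (ptime_all p2 (small_size_code s2)); apply: memE.
- by apply: (ptime_all p (small_size_code s)); apply: ptime_orb; apply: memE.
apply: ptime_orb; first exact: ptime_const.
by apply: (ptime_all p1 (small_size_code s1)); apply/ptime_negb/memE.
Qed.
End Splits.

Lemma ptime_or_sat (A : Type) (P : A -> Prop) (N : A -> nat) (enc : A -> tree)
    sem (S1 S2 : A -> seq (seq row)) (T : A -> seq row) :
  ptime P N enc (fun a => code_rows (T a)) ->
  ptime P N enc (fun a => code_seq code_rows (S1 a)) ->
  ptime P N enc (fun a => code_seq code_rows (S2 a)) ->
  small P N (fun a => tree_size (code_rows (T a))) ->
  small P N (fun a => tree_size (code_seq code_rows (S1 a))) ->
  small P N (fun a => tree_size (code_seq code_rows (S2 a))) ->
  ptime P N enc (fun a => code_bool (or_sat sem (S1 a) (S2 a) (T a))).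
Proof.
move=> p p1 p2 s s1 s2.
apply: (ptime_has p1 (small_size_code s1)).
apply: (ptime_has (ptime_elem_env _ _ p2) (small_size_code (small_elem_env _ s2))).
apply: ptime_is_split.
- exact: (ptime_elem_env (fun y => S2 y.1) _ (ptime_elem_env S1 _ p)).
- exact: (ptime_expr _ (e := ETl (EHd (EReg 0)))).
- exact: (ptime_expr _ (e := ETl (EReg 0))).
- exact: (small_elem_env (fun y => S2 y.1) (small_elem_env S1 s)).
- exact: (small_elem_env (fun y => S2 y.1) (small_elem s1)).
- exact: (small_elem (l := fun y => S2 y.1) (small_elem_env S1 s2)).
Qed.

(** * Polynomials, powers and change of instances *)

Lemma poly_nat_le (p : {poly nat}) :
  exists k, forall x, (p.[x]%R <= x.+2 ^ k)%N.
Proof.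
elim/poly_ind: p => [|p c [k IH]].
  by exists 0 => x; rewrite horner0.
(* [k.+1] serves the product with the indeterminate, [c] the constant term as [c < 2 ^ c], and the
   last successor the sum. *)
exists (k.+1 + c).+1 => x; rewrite hornerMXaddC.
apply: leq_trans (expn_sum_le _ _ _); apply: leq_add.
  by rewrite expnSr; apply: leq_mul (IH x) _; lia.
apply: leq_trans (ltnW (ltn_expl c (isT : 1 < 2))) _.
exact: leq_expn2r.
Qed.

Lemma poly_nat_expn k : exists p : {poly nat}, forall x, p.[x]%R = x.+2 ^ k.
Proof.
elim: k => [|k [p IH]]; first by exists 1%R => x; rewrite hornerC.
exists (p * 'X + p + p)%R => x; rewrite !hornerD hornerMX IH expnSr.
rewrite -[LHS]/(_ * _ + _ + _)%N; lia.
Qed.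

(** The instances correspond by a relation: an instance of [atom_checking] can be formed only when
    the current node is an atom, so no total map into them is at hand. *)
Lemma ptime_reindex_ex (A B : Type) (P : A -> Prop) (Q : B -> Prop)
    (N : A -> nat) (M m : B -> nat) (enc out : A -> tree) (enc' out' : B -> tree) :
  small Q M m ->
  (forall b, Q b -> exists a, [/\ P a, enc' b = enc a, out' b = out a & N a <= m b]) ->
  ptime P N enc out -> ptime Q M enc' out'.
Proof.
move=> sm QP [c [t [[k tk] ct]]]; exists c, (fun b => (m b).+2 ^ k); split.
  by apply: small_trans sm _; exists k.
move=> b /QP[a [Pa -> -> Na]]; have [n [s [E o l]]] := ct _ Pa.
exists n, s; split=> //; apply: leq_trans l (leq_trans (tk _ Pa) _).
exact: leq_expn2r.
Qed.

(** * Evaluating a formula in postorder on a stack *)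

Section Evaluation.
Context (L : team_logic) (sem : semantics).
Hypothesis atoms_in_P : in_P (atom_checking L).
Implicit Types (p : formula L) (n : node L).

(** The checker may accept with any tree other than [Nil]; a final test, of at most 6 steps, turns
    the answer into a [code_bool]. *)
Lemma ptime_atom_checking :
  ptime (@valid (atom_checking L)) (fun i => tree_size (code i)) (@code _)
    (fun i => code_bool `[< yes i >]).
Proof.
case: atoms_in_P => c [p cp]; have [k pk] := poly_nat_le p.
exists (Seq c (If (EReg 0) (Assign 0 (ECons ENil ENil)) (Assign 0 ENil))).
exists (fun i => (tree_size (code i)).+2 ^ k + 6); split.
  by apply: small_add; [exists k|exact: small_const].
move=> i /cp[m [s [E l yesP]]]; have lk := leq_trans l (pk _).
have [s0|s0] := pselect (s 0 = Nil).
  exists (m + (2 + 2)), (update s 0 Nil); split; last by lia.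
    apply: exec_seq E _; apply: (exec_if_false (e := EReg 0)) s0 _.
    exact: exec_assign.
  by rewrite update_eq asboolF // => /yesP.
exists (m + (2 + 4)), (update s 0 (Cons Nil Nil)); split; last by lia.
  apply: exec_seq E _; apply: (exec_if_true (e := EReg 0)) s0 _.
  exact: exec_assign.
by rewrite update_eq asboolT //; apply/yesP.
Qed.

Local Notation stack := (seq (seq (seq row))).

(** In postorder the right operand is evaluated last, so [S2] is on top of [S1]. Nodes inside atoms
    leave the stack alone; the atom itself follows them. *)
Definition eval_node (X : seq var) (st : stack) n : stack :=
  let S2 := head [::] st in
  let S1 := head [::] (behead st) in
  let rest := behead (behead st) in
  let U := subs (rows X) in
  match n with
  | NSyn _ => st
  | NForm (FTop) => U :: st
  | NForm (FBot) => [:: [::]] :: st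
  | NForm (FVar x) => [seq T <- U | literal_sat x true T] :: st
  | NForm (FNeg x) => [seq T <- U | literal_sat x false T] :: st
  | NForm (FAtom a) => [seq T <- U | `[< atom_sat (rows_team X T) a >]] :: st
  | NForm (FAnd _ _) => [seq T <- S1 | T \in S2] :: rest
  | NForm (FOr _ _) => [seq T <- U | or_sat sem S1 S2 T] :: rest
  end.

Lemma eval_syn_nodes X s st : foldl (eval_node X) st (syn_nodes L s) = st.
Proof.
by elim: s st => [x|a|a s IH|a s1 IH1 s2 IH2] st /=; rewrite ?foldl_cat /= ?IH ?IH1 ?IH2.
Qed.

Lemma eval_formula_nodes X p st :
  foldl (eval_node X) st (formula_nodes p) = sat_teams sem X p :: st.
Proof.
by elim: p st => [||x|x|a|p IHp q IHq|p IHp q IHq] st //=;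
  rewrite ?foldl_cat /= ?eval_syn_nodes ?foldl_cat ?IHp ?IHq.
Qed.

(** Membership bounds the code of each team, and the length bound controls repetitions. The height
    of the stack does not affect the time of a step, which reads at most the two top lists and moves
    the rest as one tree. *)
Definition stack_ok (X : seq var) (st : stack) : bool :=
  all (fun S => all (fun T => T \in subs (rows X)) S &&
    (size S <= size (subs (rows X)))) st.

Lemma eval_nodes_ok X l st : stack_ok X st -> stack_ok X (foldl (eval_node X) st l).
Proof.
elim: l st => //= n l IH st ok; apply: IH.
have filter_ok (p : pred (seq row)) :
    all (fun T => T \in subs (rows X)) [seq T <- subs (rows X) | p T] &&
    (size [seq T <- subs (rows X) | p T] <= size (subs (rows X))).
  rewrite size_filter count_size andbT; apply/allP => T.
  by rewrite mem_filter => /andP[].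
have rest_ok : stack_ok X (behead (behead st)).
  by case: st ok => [|S1 [|S2 st]] //= /and3P[].
case: n => [[||x|x|a|p q|p q]|s] //=; rewrite ?filter_ok //=.
- by rewrite leqnn andbT ok andbT; apply/allP.
- rewrite ok andbT andbT size_subs expn_gt0 andbT.
  by have := filter_subs pred0 (rows X); rewrite filter_pred0.
- rewrite rest_ok andbT {rest_ok}.
  case: st ok => [|S2 [|S1 st]] //= /and3P[_ /andP[/allP ok1 sz] _].
  rewrite size_filter (leq_trans (count_size _ _)) // andbT.
  by apply/allP => T; rewrite mem_filter => /andP[_ /ok1].
Qed.
End Evaluation.

(** * Size bounds for nodes, rows and lists of teams *)

Section NodeBounds.
Context (L : team_logic).
Local Open Scope fset_scope.

(** The prefix added by [code_node] has size 2 on syntax nodes and 4 on formula nodes, whence the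
    summands here and in the next bound. *)
Lemma syn_nodes_bound s : all (fun n : node L =>
  tree_size (code_node n) <= tree_size (code_syn s) + 2) (syn_nodes L s).
Proof.
elim: s => [x|a|a s IH|a s1 IH1 s2 IH2] /=; rewrite ?all_cat /= ?andbT; try lia.
- apply/andP; split; last by lia.
  by apply: sub_all IH => n; lia.
- apply/andP; split; last by lia.
  by apply/andP; split; [apply: sub_all IH1 => n|apply: sub_all IH2 => n]; lia.
Qed.

Lemma formula_nodes_bound (p : formula L) : all (fun n =>
  tree_size (code_node n) <= tree_size (code_formula p) + 4) (formula_nodes p).
Proof.
elim: p => [||x|x|a|p IHp q IHq|p IHp q IHq] /=; rewrite ?all_cat /= ?andbT; try lia.
- apply/andP; split; last by lia.
  by apply: sub_all (syn_nodes_bound _) => n; lia.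
- apply/andP; split; last by lia.
  by apply/andP; split; [apply: sub_all IHp => n|apply: sub_all IHq => n]; lia.
- apply/andP; split; last by lia.
  by apply/andP; split; [apply: sub_all IHp => n|apply: sub_all IHq => n]; lia.
Qed.

(** Provides the condition on variables in the validity of an atom instance. *)
Definition node_atom_in (X : {fset var}) (n : node L) : bool :=
  if n is NForm (FAtom a) then syn_vars (atom_syn a) `<=` X else true.

Lemma syn_nodes_atom X s : all (node_atom_in X) (syn_nodes L s).
Proof.
by elim: s => [x|a|a s IH|a s1 IH1 s2 IH2] /=; rewrite ?all_cat /= ?IH ?IH1 ?IH2.
Qed.

Lemma formula_nodes_atom X (p : formula L) :
  formula_vars p `<=` X -> all (node_atom_in X) (formula_nodes p).
Proof.
elim: p => [||x|x|a|p IHp q IHq|p IHp q IHq] //=; rewrite ?all_cat /= ?andbT.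
- by move=> ->; rewrite syn_nodes_atom.
- by rewrite fsubUset => /andP[/IHp-> /IHq->].
- by rewrite fsubUset => /andP[/IHp-> /IHq->].
Qed.
End NodeBounds.

Section Bounds.
Context (L : team_logic).
Implicit Types (p : formula L).

(** The second summand is the number of teams over the variables of [p]. *)
Definition fpt_size p : nat := tree_size (code_formula p) + 2 ^ 2 ^ variables p.

Local Notation PT := (fun _ : formula L => True).

Lemma small_formula : small PT fpt_size (fun p => tree_size (code_formula p)).
Proof. by apply: small_le (small_id _ _) => p _; apply: leq_addr. Qed.

Lemma small_expn_vars : small PT fpt_size (fun p => 2 ^ 2 ^ size (var_seq p)).
Proof. by apply: small_le (small_id _ _) => p _; rewrite size_var_seq leq_addl. Qed.

Lemma small_rows : small PT fpt_size (fun p => 2 ^ size (var_seq p)).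
Proof. exact: small_expn2 small_expn_vars. Qed.

Lemma small_var_seq :
  small PT fpt_size (fun p => tree_size (code_seq code_word (var_seq p))).
Proof.
apply: (small_le (g := fun p => (size (var_seq p) * (tree_size (code_formula p)).+1).+1)).
  move=> p _; apply: code_seq_le => x /occursP.
  by rewrite mem_var_seq; apply: code_formula_var.
do ?[apply: small_succ | apply: small_mul]; last exact: small_formula.
exact: small_expn2 small_rows.
Qed.

Lemma code_row_le p r : r \in rows (var_seq p) ->
  tree_size (code_row r) <= (size (var_seq p) * (tree_size (code_formula p) + 4).+1).+1.
Proof.
move=> rX; rewrite -{1}(rows_unzip1 rX) size_map.
apply: code_seq_le => -[x b] /occursP xr /=.
have : x \in var_seq p by rewrite -(rows_unzip1 rX); apply/mapP; exists (x, b).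
by rewrite mem_var_seq => /code_formula_var; case: (b) => /=; lia.
Qed.

Lemma small_code_rows :
  small PT fpt_size (fun p => tree_size (code_rows (rows (var_seq p)))).
Proof.
apply: (small_le (g := fun p => (2 ^ size (var_seq p) *
  (size (var_seq p) * (tree_size (code_formula p) + 4).+1).+2).+1)).
  move=> p _; rewrite -size_rows; apply: code_seq_le => r /occursP.
  exact: code_row_le.
do ?[apply: small_succ | apply: small_mul | apply: small_add]; try exact: small_const.
- exact: small_rows.
- exact: small_expn2 small_rows.
- exact: small_formula.
Qed.

Lemma small_code_subs :
  small PT fpt_size (fun p => tree_size (code_seq code_rows (subs (rows (var_seq p))))).
Proof.
apply: (small_le (g := fun p => (2 ^ 2 ^ size (var_seq p) *
  (2 ^ size (var_seq p) * (tree_size (code_rows (rows (var_seq p)))).+1).+2).+1)).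
  move=> p _; rewrite -{1}size_rows -size_subs; apply: code_seq_le => T /occursP TU.
  have Tsize : size T <= 2 ^ size (var_seq p).
    by rewrite -size_rows; apply/size_subseq/subs_subseq.
  apply: leq_trans (_ : (size T * (tree_size (code_rows (rows (var_seq p)))).+1).+1 <= _).
    apply: code_seq_le => r /occursP rT; apply/ltnW/code_size_occurs/occursP.
    by have [_] := subs_rowsP TU; apply.
  by rewrite ltnS leq_mul2r Tsize orbT.
do ?[apply: small_succ | apply: small_mul].
- exact: small_expn_vars.
- exact: small_rows.
- exact: small_code_rows.
Qed.
End Bounds.

Lemma unzip2_le (T : seq row) :
  tree_size (code_seq code_word [seq unzip2 r | r <- T]) <= tree_size (code_rows T).
Proof.
elim: T => //= r T IH.
suff: tree_size (code_word (unzip2 r)) <= tree_size (code_row r) by lia.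
by elim: r => //= e r IHr; lia.
Qed.

(** Converts the internal rows into the nameless rows that the atom checker reads. *)
Lemma ptime_unzip2 (A : Type) (P : A -> Prop) (N : A -> nat) (enc : A -> tree)
    (T : A -> seq row) :
  ptime P N enc (fun a => code_rows (T a)) ->
  small P N (fun a => tree_size (code_rows (T a))) ->
  ptime P N enc (fun a => code_seq code_word [seq unzip2 r | r <- T a]).
Proof.
move=> pT sT; apply: (ptime_map pT (small_size_code sT) (f := fun _ => unzip2)).
have sr := small_size_code (small_elem sT).
apply: (ptime_map (l := snd) (ptime_elem_id _ _ _ _ _) sr (f := fun _ e => e.2)).
exact: (ptime_expr _ (e := ETl (ETl (EReg 0)))).
Qed.

(** * The time of one evaluation step *)

Section EvaluationTime.
Context (L : team_logic) (sem : semantics).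
Hypothesis atoms_in_P : in_P (atom_checking L).
Implicit Types (p : formula L) (n : node L).
Local Notation stack := (seq (seq (seq row))).
Local Notation PT := (fun _ : formula L => True).
Local Notation code_stack := (code_seq (code_seq code_rows)).
Local Notation U p := (subs (rows (var_seq p))).

(** The variables and the list of all teams are computed once and stay available to every step of
    the fold over the nodes. *)
Definition eval_enc p : tree :=
  Cons (Cons (code_seq code_word (var_seq p)) (code_seq code_rows (U p)))
    (code_seq (@code_node L) (formula_nodes p)).

Lemma ptime_eval_enc : ptime PT (@fpt_size L) (@code_formula L) eval_enc.
Proof.
have pn : ptime PT (@fpt_size L) (@code_formula L)
    (fun p => code_seq (@code_node L) (formula_nodes p)).
  exact: (ptime_nodes (p := id)) (small_formula L).
have pX := ptime_var_seq (p := id) (small_formula L) pn.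
apply: ptime_cons => //; apply: ptime_cons => //.
apply: ptime_subs; first exact: ptime_rows (small_rows L).
by apply: small_le (small_expn_vars L) => p _; rewrite size_rows.
Qed.

Let Q (x : formula L * stack * node L) : Prop :=
  occurs x.2 (formula_nodes x.1.1) /\ stack_ok (var_seq x.1.1) x.1.2.
Let M (x : formula L * stack * node L) := fpt_size x.1.1.
Let enc (x : formula L * stack * node L) : tree :=
  Cons (eval_enc x.1.1) (Cons (code_stack x.1.2) (code_node x.2)).

Lemma small_state (R : formula L * stack * node L -> Prop) (f : formula L -> nat) :
  small PT (@fpt_size L) f -> small R M (fun x => f x.1.1).
Proof. exact: (small_reindex (h := fun x : formula L * stack * node L => x.1.1)). Qed.

Let U_reg := ETl (EHd (EHd (EReg 0))).
Let st_reg := EHd (ETl (EReg 0)).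
Let arg_reg := ETl (ETl (ETl (ETl (EReg 0)))).

Lemma ptime_eval_node : ptime Q M enc
  (fun x => code_stack (eval_node sem (var_seq x.1.1) x.1.2 x.2)).
Proof.
apply: (ptime_case_node (n := snd)).
  exact: (ptime_expr _ (e := ETl (ETl (EReg 0)))).
pose top (x : formula L * stack * node L) := head [::] x.1.2.
pose sec (x : formula L * stack * node L) := head [::] (behead x.1.2).
have pU R : ptime R M enc (fun x => code_seq code_rows (U x.1.1)).
  exact: (ptime_expr _ (e := U_reg)).
have ptop R : ptime R M enc (fun x => code_seq code_rows (top x)).
  by apply: (ptime_expr _ (e := EHd st_reg)) => -[[p [|S st]] n].
have psec R : ptime R M enc (fun x => code_seq code_rows (sec x)).
  by apply: (ptime_expr _ (e := EHd (ETl st_reg))) => -[[p [|S1 [|S2 st]]] n].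
have prest R : ptime R M enc (fun x => code_stack (behead (behead x.1.2))).
  by apply: (ptime_expr _ (e := ETl (ETl st_reg))) => -[[p [|S1 [|S2 st]]] n].
have pst R : ptime R M enc (fun x => code_stack x.1.2).
  exact: (ptime_expr _ (e := st_reg)).
have sU R : small R M (fun x => tree_size (code_seq code_rows (U x.1.1))).
  exact: (small_state _ (small_code_subs L)).
(* Turns the two conditions of [stack_ok] into a bound on the code of a list: at most as many
   entries as [U], each no larger than the code of [U]. *)
have sS (R : formula L * stack * node L -> Prop) S :
    (forall x, R x ->
       all (fun T => T \in U x.1.1) (S x) /\ size (S x) <= size (U x.1.1)) ->
    small R M (fun x => tree_size (code_seq code_rows (S x))).
  move=> RS; apply: (small_le (g := fun x => (tree_size (code_seq code_rows (U x.1.1)) *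
      (tree_size (code_seq code_rows (U x.1.1))).+1).+1)).
    move=> x /RS[/allP SU sz]; apply: leq_trans (_ : (size (S x) *
      (tree_size (code_seq code_rows (U x.1.1))).+1).+1 <= _).
      by apply: code_seq_le => T /occursP/SU/occursP/(code_size_occurs code_rows)/ltnW.
    rewrite ltnS leq_mul2r (leq_trans sz) ?orbT //.
    exact/ltnW/size_code_seq.
  by apply: small_succ; apply: small_mul; last apply: small_succ.
have ok_top x : Q x ->
    all (fun T => T \in U x.1.1) (top x) /\ size (top x) <= size (U x.1.1).
  by case: x => [[p [|S st]] n] [_] //= /andP[/andP[]].
have ok_sec x : Q x ->
    all (fun T => T \in U x.1.1) (sec x) /\ size (sec x) <= size (U x.1.1).
  by case: x => [[p [|S [|S' st]]] n] [_] //= /and3P[_ /andP[]].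
have plit b (R : formula L * stack * node L -> Prop) :
    (forall x, R x -> Q x /\ (x.2 = NForm (FVar L (odflt [::] (node_var x.2))) \/
                               x.2 = NForm (FNeg L (odflt [::] (node_var x.2))))) ->
    ptime R M enc (fun x => code_stack
      ([seq T <- U x.1.1 | literal_sat (odflt [::] (node_var x.2)) b T] :: x.1.2)).
  move=> RQ; apply: ptime_cons => //.
  have px : ptime R M enc (fun x => code_word (odflt [::] (node_var x.2))).
    apply: (ptime_expr _ (e := arg_reg)).
    by move=> x /RQ[_ [] /= E]; rewrite E /=.
  have sx : small R M (fun x => tree_size (code_word (odflt [::] (node_var x.2)))).
    apply: small_le (small_state R (small_formula L)).
    move=> x /RQ[[[l1 [l2 E]] _] En].
    apply: code_formula_var; rewrite -has_formula_vars E has_cat /=.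
    by case: En => -> /=; rewrite eqxx orbT.
  apply: (ptime_filter (pU R) (small_size_code (sU R))
    (p := fun x => literal_sat (odflt [::] (node_var x.2)) b)).
  apply: ptime_literal.
  - exact: (ptime_elem_env (fun x => U x.1.1) _ px).
  - exact: (ptime_expr _ (e := ETl (EReg 0))).
  - exact: (small_elem_env (fun x => U x.1.1) sx).
  - exact: (small_elem (l := fun x => U x.1.1) (sU R)).
move=> [|[|[|[|[|[|[|[|[|[|[|//]]]]]]]]]]] _.
1-4: by apply: ptime_ext_out (pst _) => -[[p st] n] [_]; case: n => -[].
- apply: ptime_ext_out (ptime_cons (pU _) (pst _)).
  by move=> -[[p st] n] [_]; case: n => -[].
- apply: ptime_ext_out (ptime_cons (ptime_const (Cons Nil Nil)) (pst _)).
  by move=> -[[p st] n] [_]; case: n => -[].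
- apply: ptime_ext_out (plit true _ _); first by move=> -[[p st] n] [_]; case: n => -[].
  by move=> -[[p st] n] [Qx]; case: n Qx => -[] // x Qx _; split=> //; left.
- apply: ptime_ext_out (plit false _ _); first by move=> -[[p st] n] [_]; case: n => -[].
  by move=> -[[p st] n] [Qx]; case: n Qx => -[] // x Qx _; split=> //; right.
(* The value [false] is a default outside atom nodes, which the tag excludes here. *)
- pose holds (x : formula L * stack * node L) T :=
    if x.2 is NForm (FAtom a) then `[< atom_sat (rows_team (var_seq x.1.1) T) a >]
    else false.
  apply: (ptime_ext_out (out := fun x => Cons (code_seq code_rows
     [seq T <- U x.1.1 | holds x T]) (code_stack x.1.2))).
    by move=> -[[p st] n] [_]; case: n => -[].
  apply: ptime_cons => //; set R := fun x => _.
  apply: (ptime_filter (pU R) (small_size_code (sU R)) (p := holds)).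
  have parg : ptime R M enc (fun x => tl (tl (code_node x.2))).
    exact: (ptime_expr _ (e := arg_reg)).
  have pX : ptime R M enc (fun x => code_seq code_word (var_seq x.1.1)).
    exact: (ptime_expr _ (e := EHd (EHd (EHd (EReg 0))))).
  have sT := small_elem (l := fun x => U x.1.1) (sU R).
  apply: (ptime_comp (mid := fun y : formula L * stack * node L * seq row =>
    Cons (tl (tl (code_node y.1.2))) (Cons (code_seq code_word (var_seq y.1.1.1))
      (code_seq code_word [seq unzip2 r | r <- y.2])))).
    apply: ptime_cons; first exact: (ptime_elem_env (fun x => U x.1.1) _ parg).
    apply: ptime_cons; first exact: (ptime_elem_env (fun x => U x.1.1) _ pX).
    apply: ptime_unzip2 sT.
    exact: (ptime_expr _ (e := ETl (EReg 0))).
  (* [m] bounds the input of the checker by small quantities, so its time, polynomial in that input,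
     is polynomial in [fpt_size]. The 4 comes from [formula_nodes_bound]. *)
  apply: (ptime_reindex_ex (m := fun y => (tree_size (code_formula y.1.1.1) + 4 +
    (tree_size (code_seq code_word (var_seq y.1.1.1)) +
       tree_size (code_rows y.2)).+1).+1)) (ptime_atom_checking atoms_in_P).
    apply: small_succ; apply: small_add.
      apply: small_add; last exact: small_const.
      exact: (small_elem_env (fun x => U x.1.1) (small_state R (small_formula L))).
    apply: small_succ; apply: small_add sT.
    exact: (small_elem_env (fun x => U x.1.1) (small_state R (small_var_seq L))).
  move=> -[[[p st] n] T] [[[/= occ _] /= tg] /occursP /= TU].
  case: n occ tg TU => -[] // a occ _ TU /=.
  have [uT TX] := subs_rowsP TU; have uX := var_seq_uniq p.
  have tableE : code_seq code_word [seq unzip2 r | r <- T] =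
      code_seq (fun t : assignment =>
          code_word [seq t.[? x]%fmap == Some true | x <- var_seq p])
        [seq row_assignment (var_seq p) r | r <- T].
    elim: T TX {uT TU} => //= r T IH TX; rewrite IH; last first.
      by move=> r' r'T; apply: TX; rewrite inE r'T orbT.
    congr (Cons (code_word _) _).
    rewrite -[in LHS](row_assignmentK uX (TX r (mem_head _ _))).
    by rewrite /unzip2 -map_comp.
  exists (@AtomInstance L a (var_seq p) [seq row_assignment (var_seq p) r | r <- T]).
  split.
  + split=> /=.
    * exact: uX.
    * rewrite map_inj_in_uniq // => r1 r2 /TX r1X /TX r2X.
      exact: (row_assignment_inj uX).
    * exact: rows_team_over.
    * have sub : (formula_vars p `<=` [fset x in var_seq p])%fset.
        by rewrite formula_varsE.
      have := formula_nodes_atom sub; case: occ => l1 [l2 /= ->].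
      by rewrite all_cat => /andP[_ /andP[]].
  + by rewrite /code /= /code_table tableE.
  + by [].
  + rewrite /= /code_table -tableE.
    have : tree_size (code_syn (atom_syn a)) <= tree_size (code_formula p) + 4.
      have := formula_nodes_bound p; case: occ => l1 [l2 /= ->].
      by rewrite all_cat => /andP[_ /andP[]] /=; lia.
    have := unzip2_le T; lia.
- apply: (ptime_ext_out (out := fun x => Cons (code_seq code_rows
     [seq T <- sec x | T \in top x]) (code_stack (behead (behead x.1.2))))).
    by move=> -[[p st] n] [_]; case: n => -[].
  apply: ptime_cons => //; set R := fun x => _.
  have ssec : small R M (fun x => tree_size (code_seq code_rows (sec x))).
    by apply: sS => x [Qx _]; apply: ok_sec.
  have stop : small R M (fun x => tree_size (code_seq code_rows (top x))).
    by apply: sS => x [Qx _]; apply: ok_top.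
  apply: (ptime_filter (psec R) (small_size_code ssec) (p := fun x T => T \in top x)).
  apply: ptime_mem.
  + exact: code_rows_inj.
  + exact: (ptime_expr _ (e := ETl (EReg 0))).
  + exact: (ptime_elem_env sec _ (ptop R)).
  + exact: (small_elem (l := sec) ssec).
  + exact: (small_elem_env sec (small_size_code stop)).
- apply: (ptime_ext_out (out := fun x => Cons (code_seq code_rows
     [seq T <- U x.1.1 | or_sat sem (sec x) (top x) T])
     (code_stack (behead (behead x.1.2))))).
    by move=> -[[p st] n] [_]; case: n => -[].
  apply: ptime_cons => //; set R := fun x => _.
  have ssec : small R M (fun x => tree_size (code_seq code_rows (sec x))).
    by apply: sS => x [Qx _]; apply: ok_sec.
  have stop : small R M (fun x => tree_size (code_seq code_rows (top x))).
    by apply: sS => x [Qx _]; apply: ok_top.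
  apply: (ptime_filter (pU R) (small_size_code (sU R))
    (p := fun x => or_sat sem (sec x) (top x))).
  apply: ptime_or_sat.
  + exact: (ptime_expr _ (e := ETl (EReg 0))).
  + exact: (ptime_elem_env (fun x => U x.1.1) _ (psec R)).
  + exact: (ptime_elem_env (fun x => U x.1.1) _ (ptop R)).
  + exact: (small_elem (l := fun x => U x.1.1) (sU R)).
  + exact: (small_elem_env (fun x => U x.1.1) ssec).
  + exact: (small_elem_env (fun x => U x.1.1) stop).
Qed.
End EvaluationTime.

Lemma ptime_satisfiable (L : team_logic) (sem : semantics) :
  in_P (atom_checking L) ->
  ptime (fun _ => True) (@fpt_size L) (@code_formula L)
    (fun p => code_bool `[< satisfiable sem p >]).
Proof.
move=> atoms_in_P; apply: ptime_comp (ptime_eval_enc L) _.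
pose S (p : formula L) := sat_teams sem (var_seq p) p.
apply: (ptime_comp (mid := fun p => code_seq code_rows (S p))).
  apply: (ptime_ext_out (out := fun p => hd (code_seq (code_seq code_rows)
    (foldl (eval_node sem (var_seq p)) [::] (formula_nodes p))))).
    by move=> p _; rewrite eval_formula_nodes.
  apply: ptime_hd; apply: (ptime_foldl (l := @formula_nodes L) (cI := @code_node L) _ _
    (s0 := fun _ => [::]) (g := fun p => eval_node sem (var_seq p))).
  - exact: (ptime_expr _ (e := ETl (EReg 0))).
  - by apply: small_le (small_formula L) => p _; apply: size_formula_nodes.
  - exact: ptime_const Nil.
  - apply: ptime_sub (ptime_eval_node sem atoms_in_P).
    move=> [[p st] n] /= [_ [l1 [l2 [E ->]]]]; split; first by exists l1, l2.
    exact: eval_nodes_ok.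
apply: (ptime_ext_out (out := fun p => code_bool (has (fun T => T != [::]) (S p)))).
  move=> p _; congr code_bool.
  have E := satisfiableP sem (var_seq_uniq p) (formula_varsE p).
  by apply/asboolP/idP; case: E.
apply: (ptime_has (cI := code_rows)); first exact: ptime_id.
  apply: small_le (small_size_code (small_code_subs L)) => p _.
  exact: size_sat_teams.
(* The empty team has code [Nil], so the code itself is the test. *)
apply: (ptime_case (test := fun y => code_rows y.2)).
- exact: (ptime_expr _ (e := ETl (EReg 0))).
- apply: ptime_ext_out (ptime_const (code_bool true)).
  by move=> [p [|r T]] [].
- apply: ptime_ext_out (ptime_const (code_bool false)).
  by move=> [p [|r T]] [].
Qed.

(** * The running time *)

(** A unary number is coded like a list of units, so doubling is concatenation of a list with
    itself, repeated [k a] times. *)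
Lemma ptime_exp2 (A : Type) (P : A -> Prop) (N : A -> nat) (enc : A -> tree)
    (k : A -> nat) :
  ptime P N enc (fun a => code_nat (k a)) ->
  small P N (fun a => 2 ^ k a) ->
  ptime P N enc (fun a => code_nat (2 ^ k a)).
Proof.
move=> pk sk; pose c (_ : unit) := Nil.
have codeE n : code_nat n = code_seq c (nseq n tt) by elim: n => //= n ->.
have expE n : foldl (fun s (_ : unit) => s + s) 1 (nseq n tt) = 2 ^ n.
  suff E m : foldl (fun s (_ : unit) => s + s) m (nseq n tt) = m * 2 ^ n.
    by rewrite E mul1n.
  by elim: n m => [|n IH] m /=; rewrite ?muln1 // IH addnn -mul2n expnS; lia.
apply: (ptime_ext_out (out := fun a => code_nat
  (foldl (fun s (_ : unit) => s + s) 1 (nseq (k a) tt)))).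
  by move=> a _; rewrite expE.
apply: (ptime_foldl (cI := c) _ _ (s0 := fun _ => 1) (g := fun _ s _ => s + s)).
- by apply: ptime_ext_out pk => a _; rewrite codeE.
- by apply: small_le (small_expn2 sk) => a _; rewrite size_nseq.
- exact: ptime_const (code_nat 1).
set Q := fun x : A * nat * unit => _.
have ps : ptime Q (fun x => N x.1.1)
    (fun x => Cons (enc x.1.1) (Cons (code_nat x.1.2) (c x.2)))
    (fun x => code_seq c (nseq x.1.2 tt)).
  apply: ptime_ext_out (ptime_expr _ (e := EHd (ETl (EReg 0))) (fun a _ => erefl)).
  by move=> x _ /=; rewrite codeE.
apply: (ptime_ext_out (out := fun x => code_seq c (nseq x.1.2 tt ++ nseq x.1.2 tt))).
  by move=> x _; rewrite codeE nseqD.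
apply: ptime_cat => //.
apply: (small_le (g := fun x => 2 ^ k x.1.1)).
  move=> [[a s] i]; rewrite /Q /= => -[_ [l1 [l2 [E ->]]]].
  have -> : l1 = nseq (size l1) tt by apply/all_pred1P; apply/allP => -[].
  rewrite expE size_nseq leq_exp2l //.
  by have := congr1 size E; rewrite size_nseq size_cat /=; lia.
by apply: (small_reindex (h := fun x : A * nat * unit => x.1.1)) sk => // x [].
Qed.

(** Computability asks for no time bound, so the final value itself can serve as the measure, and
    all lower towers are small. *)
Lemma computable_tower : computable (fun k => 2 ^ 2 ^ 2 ^ 2 ^ k).
Proof.
pose N k := 2 ^ 2 ^ 2 ^ 2 ^ k.
have s4 : small (fun _ : nat => True) N N by exact: small_id.
have s3 := small_expn2 s4; have s2 := small_expn2 s3; have s1 := small_expn2 s2.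
have p1 := ptime_exp2 (ptime_id (enc := code_nat)) s1.
have [c [t [_ ct]]] := ptime_exp2 (ptime_exp2 (ptime_exp2 p1 s2) s3) s4.
by exists c => k; have [n [s [E o _]]] := ct k I; exists n, s.
Qed.

(** Each of the [k] factors of the falling factorial is at least [n.+1]. *)
Lemma expn_le_ffact n k : n.+1 ^ k <= (n + k) ^_ k.
Proof.
elim: k => // k IH; rewrite addnS ffactSS expnS.
by apply: leq_mul IH; rewrite ltnS leq_addr.
Qed.

Lemma bin_le_exp2 n k : 'C(n, k) <= 2 ^ n.
Proof.
elim: n k => [|n IH] [|k] //; rewrite ?bin0 ?expn_gt0 //.
by rewrite binS expnS mul2n -addnn leq_add.
Qed.

(** The exponent [k] stems from the atom checker, hence depends on the logic; the
    extra exponential makes the bound on the time independent of it. *)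
Lemma expn_le_exp2 n k : n.+1 ^ k <= k`! * 2 ^ k * 2 ^ n.
Proof.
apply: leq_trans (expn_le_ffact n k) _; rewrite -bin_ffact mulnC -mulnA.
by rewrite leq_mul2l -expnD addnC bin_le_exp2 orbT.
Qed.

Lemma satisfiability_in_FPT (L : team_logic) (sem : semantics)
    (kappa : formula L -> nat) :
  in_P (atom_checking L) -> (forall p : formula L, variables p <= 2 ^ kappa p) ->
  @in_FPT (satisfiability L sem) kappa.
Proof.
move=> atoms_in_P vk.
have psat : ptime (fun _ => True) (@fpt_size L)
    (fun p => Cons (code_formula p) (code_nat (kappa p)))
    (fun p => code_bool `[< satisfiable sem p >]).
  apply: (ptime_comp (mid := @code_formula L)); last exact: ptime_satisfiable.
  exact: (ptime_expr _ (e := EHd (EReg 0))).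
have [c [t [[k tk] ct]]] := psat; have [q qE] := poly_nat_expn k.
(* The innermost exponential bounds the number of variables, the next two the number of teams, and
   the outermost absorbs the exponent of the time bound. The factors depending on that exponent
   alone go into the polynomial. *)
exists c, (fun k => 2 ^ 2 ^ 2 ^ 2 ^ k), ((k`! * 2 ^ k)%:P * q)%R.
split=> [|p _]; first exact: computable_tower.
have [n [s [E o l]]] := ct p I; exists n, s; split=> //; last first.
  by rewrite o; split=> [|/asboolT->//]; case: asboolP.
apply: leq_trans l (leq_trans (tk p I) _); rewrite hornerCM qE.
set m := tree_size (code_formula p); set y := 2 ^ 2 ^ variables p.
have yk : 2 ^ y <= 2 ^ 2 ^ 2 ^ 2 ^ kappa p by rewrite !leq_exp2l.
(* Bounding the sum [m + y + 2] by a product separates the formula from the parameter. *)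
apply: leq_trans (_ : (m.+2 * y.+1) ^ k <= _).
  by apply: leq_expn2r; rewrite /fpt_size -/m -/y; nia.
rewrite expnMn; have := expn_le_exp2 y k.
rewrite -[X in _ -> _ <= X]/(_ * (_ * _))%N -/m.
move=> /leq_trans/(_ (leq_mul (leqnn _) yk)) h.
apply: leq_trans (leq_mul (leqnn _) h) _.
by rewrite eq_leq //; lia.
Qed.

(** * The parameters *)

Section VariableBounds.
Local Open Scope fset_scope.

Lemma card_fsetU_le (K : choiceType) (X Y : {fset K}) : #|` X `|` Y| <= #|` X| + #|` Y|.
Proof. by rewrite cardfsU leq_subr. Qed.

Lemma exp2_max m n : 2 ^ m + 2 ^ n <= 2 ^ (maxn m n).+1.
Proof.
by rewrite expnS mul2n -addnn leq_add // leq_exp2l // ?leq_maxl ?leq_maxr.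
Qed.

Lemma card_syn_vars_size s : #|` syn_vars s| <= syn_size s.
Proof.
elim: s => [x|a|a s IH|a s1 IH1 s2 IH2] /=; rewrite ?cardfs1 ?cardfs0 //.
  exact: leqW.
by apply: leqW; apply: leq_trans (card_fsetU_le _ _) (leq_add IH1 IH2).
Qed.

(** Variables label leaves, and a tree of fan-out at most two has at most [2 ^ d] leaves at depth
    [d]. *)
Lemma card_syn_vars_depth s : #|` syn_vars s| <= 2 ^ syn_depth s.
Proof.
elim: s => [x|a|a s IH|a s1 IH1 s2 IH2] /=; rewrite ?cardfs1 ?cardfs0 //.
  by apply: leq_trans IH _; rewrite leq_exp2l.
apply: leq_trans (card_fsetU_le _ _) (leq_trans (leq_add IH1 IH2) _).
exact: exp2_max.
Qed.

Lemma variables_size (L : team_logic) (p : formula L) : variables p <= formula_size p.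
Proof.
rewrite /variables; elim: p => [||x|x|a|p IHp q IHq|p IHp q IHq] /=;
  rewrite ?cardfs1 ?cardfs0 ?card_syn_vars_size //;
  by apply: leqW; apply: leq_trans (card_fsetU_le _ _) (leq_add IHp IHq).
Qed.

Lemma variables_depth (L : team_logic) (p : formula L) :
  variables p <= 2 ^ formula_depth p.
Proof.
rewrite /variables; elim: p => [||x|x|a|p IHp q IHq|p IHp q IHq] /=;
  rewrite ?cardfs1 ?cardfs0 ?card_syn_vars_depth //;
  by apply: leq_trans (card_fsetU_le _ _) (leq_trans (leq_add IHp IHq) (exp2_max _ _)).
Qed.
End VariableBounds.

Theorem theorem2 (L : team_logic) (sem : semantics) :
  in_P (atom_checking L) ->
  [/\ @in_FPT (satisfiability L sem) (@formula_size L),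
      @in_FPT (satisfiability L sem) (@formula_depth L)
    & @in_FPT (satisfiability L sem) (@variables L)].
Proof.
(* For the size and the number of variables, [n < 2 ^ n] weakens the linear bound to the exponential
   one that the depth requires. *)
move=> atoms_in_P; split; apply: satisfiability_in_FPT => // p.
- exact: leq_trans (variables_size p) (ltnW (ltn_expl _ _)).
- exact: variables_depth.
- exact/ltnW/ltn_expl.
Qed.
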